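(* The tetrahedron $\Delta$ is a strict local maximizer for lattice width (with respect to $\Lambda$) among hollow convex bodies in $\mathbb{R}^3$. More precisely, there exists an open set $U\subset\mathbb{R}^3$ containing $\Delta$ such that every convex body $K\subset U$ that is hollow with respect to $\Lambda$ and different from $\Delta$ satisfies $\operatorname{width}_\Lambda(K)<2+\sqrt2$.
   Context: $\Delta=\operatorname{conv}(a_1,a_2,a_3,a_4)\subset\mathbb{R}^3$ with $a_1=(2+\sqrt2,\ \sqrt2,\ 2+\sqrt2)$, $a_2=(-\sqrt2,\ 2+\sqrt2,\ -2-\sqrt2)$, $a_3=(-2-\sqrt2,\ -\sqrt2,\ 2+\sqrt2)$, $a_4=(\sqrt2,\ -2-\sqrt2,\ -2-\sqrt2)$. $\Lambda=\{(a,b,c): a,b,c\in 1+2\mathbb{Z},\ a+b+c\in 1+4\mathbb{Z}\}$, an affine lattice. For an affine lattice $\Lambda$, let $\vec\Lambda=\Lambda-\Lambda$ be the associated linear lattice and $\vec\Lambda^*$ its dual lattice (linear functionals taking integer values on $\vec\Lambda$). A convex body is a compact convex set with nonempty interior. A convex body $K\subset\mathbb{R}^3$ is hollow with respect to $\Lambda$ if $\Lambda$ does not intersect the interior of $K$. For a linear functional $f$, $\operatorname{width}(K,f)$ is the length of the segment $f(K)$, and $\operatorname{width}_\Lambda(K)$ is the minimum of $\operatorname{width}(K,f)$ over all nonzero $f\in\vec\Lambda^*$. The tetrahedron $\Delta$ is hollow with respect to $\Lambda$ and $\operatorname{width}_\Lambda(\Delta)=2+\sqrt2$. *)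

(* Defs.v *)
From HB Require Import structures.
From mathcomp Require Import all_boot all_order all_algebra.
From mathcomp Require Import all_classical all_reals all_analysis.

Set Implicit Arguments.
Unset Strict Implicit.
Unset Printing Implicit Defensive.

Import Order.TTheory GRing.Theory Num.Theory.
Import numFieldNormedType.Exports.

Local Open Scope classical_set_scope.
Local Open Scope ring_scope.

Definition convex_body (R : realType) (n : nat) (K : set 'rV[R]_n) : Prop :=
  [/\ compact K, convex_set K & K° !=set0].

Definition convex_hull (R : realType) (n : nat) (A : set 'rV[R]_n) :
  set 'rV[R]_n := smallest (fun C => convex_set C) A.

(* [L] stands for an affine lattice. *)
Definition hollow (R : realType) (n : nat) (L K : set 'rV[R]_n) : Prop :=
  L `&` K° = set0.

Definition linear_lattice (R : realType) (n : nat) (L : set 'rV[R]_n) :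
  set 'rV[R]_n := [set x - y | x in L & y in L].

Definition dual_lattice (R : realType) (n : nat) (M : set 'rV[R]_n) :
  set {scalar 'rV[R]_n} := [set f | forall v, M v -> f v \is a Num.int].

(* For a convex body [K], [f @` K] is the segment [[inf, sup]]. *)
Definition width (R : realType) (n : nat) (K : set 'rV[R]_n)
  (f : {scalar 'rV[R]_n}) : R := sup (f @` K) - inf (f @` K).

(* The minimum over nonzero [f] is written as an infimum. It is attained when
   [L] is an affine lattice of full rank and [K] is a convex body: [K] contains
   a ball, so only finitely many [f] have width below a given bound. *)
Definition lattice_width (R : realType) (n : nat) (L K : set 'rV[R]_n) : R :=
  inf [set width K f | f in
         [set f | dual_lattice (linear_lattice L) f /\ exists x, f x != 0]].

Definition vec3 (R : realType) (x y z : R) : 'rV[R]_3 :=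
  \row_(j < 3) [:: x; y; z]`_j.

Definition Lambda (R : realType) : set 'rV[R]_3 :=
  [set p | exists a b c k : int,
    p = vec3 (1 + 2 * a)%:~R (1 + 2 * b)%:~R (1 + 2 * c)%:~R /\
    (1 + 2 * a) + (1 + 2 * b) + (1 + 2 * c) = 1 + 4 * k].

Definition Delta (R : realType) : set 'rV[R]_3 :=
  let s : R := Num.sqrt 2 in
  convex_hull [set vec3 (2 + s) s (2 + s);
                   vec3 (- s) (2 + s) (- 2 - s);
                   vec3 (- 2 - s) (- s) (2 + s);
                   vec3 s (- 2 - s) (- 2 - s)].

(* Main.v *)
Require Import Defs.
From HB Require Import structures.
From mathcomp Require Import all_boot all_order all_algebra.
From mathcomp Require Import all_classical all_reals all_analysis.
From mathcomp Require Import ring lra zify.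

Set Implicit Arguments.
Unset Strict Implicit.
Unset Printing Implicit Defensive.

Import Order.TTheory GRing.Theory Num.Theory.
Import numFieldNormedType.Exports.

Local Open Scope classical_set_scope.
Local Open Scope ring_scope.

(** Write s for the square root of 2. Two families of facts drive the local
    maximality. Each facet of Delta has exactly one lattice point in its
    relative interior, the [contact_point]s, and each of the six edges of Delta
    carries a functional of the dual lattice, among x/2, y/2 and
    (+-x +-y +-z)/4, whose width 2 + s on Delta is attained between the two
    ends of that edge. All the data are permuted cyclically by the rotation
    (x, y, z) |-> (-y, x, -z), which preserves both Lambda and Delta; this is
    why, in barycentric coordinates of Delta, they form circulant matrices with
    vertices indexed modulo 4.

    Let K be hollow, contained in a small neighbourhood of Delta, and of lattice
    width at least 2 + s. The functionals x/2 and y/2 force K to come close to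
    every vertex of Delta ([near_vertex]). The contact points are not interior
    to K, so [supporting_hyperplane] gives four half-spaces containing K with
    the contact points on their boundaries; being tight near the vertices, their
    boundaries are close to the facets of Delta ([supporting_form]). After
    rescaling ([scale_forms]) they cut out a tetrahedron T containing K. Let
    B = 1 + b hold the barycentric coordinates of T evaluated at the vertices of
    Delta, and let 1 + w be its inverse, whose rows locate the vertices of T in
    Delta. In these terms the contact conditions are linear, namely that P b has
    zero diagonal, where P is the matrix [contact]; and since each edge
    functional is at most as wide on K as its drop along the corresponding edge
    of T ([edge_width_ge]), the drops contributed by w are nonnegative.

    That such a b vanishes is [rigidity]. To first order, a combination of the
    six drops of w with positive weights equals - tr(P w)
    ([edge_width_multipliers]), hence is - tr(P b b) up to third order. This
    first order condition does not settle the matter, because the six drops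
    vanish on a three-dimensional space of admissible b. There the quadratic
    form tr(P b b) is positive definite: [second_order_identity] writes it as a
    positive form minus products of drops with linear forms, and those products
    are negligible against the multipliers. Therefore T = Delta, so K lies in
    Delta, and applying [near_vertex] once more, now without error, shows that K
    contains the vertices of Delta.

    Hollowness of Delta is a finite check once its coordinates are bounded by 4.
    For its lattice width, a dual functional has integer values X, Y, Z on four
    times the coordinate vectors, with equal parities; if its width were below
    2 + s, the six edges of Delta would bound X, Y, Z so tightly that they all
    vanish ([small_dual_zero]). *)

(** * Four-point and three-point index types *)

Notation o0 := (@Ordinal 4 0 isT).
Notation o1 := (@Ordinal 4 1 isT).
Notation o2 := (@Ordinal 4 2 isT).
Notation o3 := (@Ordinal 4 3 isT).

Notation k0 := (@Ordinal 3 0 isT).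
Notation k1 := (@Ordinal 3 1 isT).
Notation k2 := (@Ordinal 3 2 isT).

Lemma sum4 (V : zmodType) (F : 'I_4 -> V) :
  \sum_i F i = F o0 + F o1 + F o2 + F o3.
Proof.
rewrite !big_ord_recr big_ord0 /= add0r.
by do ![congr (_ + _)]; congr F; apply: val_inj.
Qed.

Lemma forall4 (Q : 'I_4 -> Prop) :
  Q o0 -> Q o1 -> Q o2 -> Q o3 -> forall i, Q i.
Proof.
by move=> Q0 Q1 Q2 Q3 [[|[|[|[|//]]]] lti];
  [move: Q0|move: Q1|move: Q2|move: Q3]; congr Q; apply: val_inj.
Qed.

Lemma ord4D :
  ((((o0 + 1)%R = o1) * ((o1 + 1)%R = o2) *
    ((o2 + 1)%R = o3) * ((o3 + 1)%R = o0)) *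
   (((o0 + 2)%R = o2) * ((o1 + 2)%R = o3) *
    ((o2 + 2)%R = o0) * ((o3 + 2)%R = o1)) *
   (((o0 + 3)%R = o3) * ((o1 + 3)%R = o0) *
    ((o2 + 3)%R = o1) * ((o3 + 3)%R = o2)))%type.
Proof. by do ![split]; apply: val_inj. Qed.

Lemma sum4_from (V : zmodType) (F : 'I_4 -> V) i :
  \sum_k F k = F i + F (i + 1) + F (i + 2) + F (i + 3).
Proof.
move: i; apply: forall4; rewrite sum4 !ord4D //.
- by rewrite [RHS](ACl (4 * 1 * 2 * 3)).
- by rewrite [RHS](ACl (3 * 4 * 1 * 2)).
- by rewrite [RHS](ACl (2 * 3 * 4 * 1)).
Qed.

Lemma ord4_cases (i : 'I_4) (Q : 'I_4 -> Prop) :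
  Q i -> Q (i + 1) -> Q (i + 2) -> Q (i + 3) -> forall k, Q k.
Proof. by move: i; apply: forall4; rewrite !ord4D => *; apply: forall4. Qed.

Lemma sum3 (V : zmodType) (F : 'I_3 -> V) : \sum_i F i = F k0 + F k1 + F k2.
Proof.
rewrite !big_ord_recr big_ord0 /= add0r.
by do ![congr (_ + _)]; congr F; apply: val_inj.
Qed.

Lemma forall3 (Q : 'I_3 -> Prop) : Q k0 -> Q k1 -> Q k2 -> forall i, Q i.
Proof.
by move=> Q0 Q1 Q2 [[|[|[|//]]] lti];
  [move: Q0|move: Q1|move: Q2]; congr Q; apply: val_inj.
Qed.

Lemma row3P (R : realType) (x y : 'rV[R]_3) :
  x 0 k0 = y 0 k0 -> x 0 k1 = y 0 k1 -> x 0 k2 = y 0 k2 -> x = y.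
Proof. by move=> *; apply/rowP; apply: forall3. Qed.

(** * Matrix norms *)

Section MatrixNorm.
Variable R : realType.
Implicit Types (a d : 'M[R]_4).

Lemma ler_mx_entry m n (a : 'M[R]_(m, n)) i j : `|a i j| <= `|a|.
Proof.
rewrite [leRHS]/Num.norm /= mx_normrE.
by apply/bigmax_geP; right; exists (i, j).
Qed.

Lemma mx_norm_le m n (a : 'M[R]_(m, n)) x :
  0 <= x -> (forall i j, `|a i j| <= x) -> `|a| <= x.
Proof.
by move=> x0 ax; rewrite [leLHS]/Num.norm /= mx_normrE; apply/bigmax_leP.
Qed.

Lemma mulmx_norm_le m n p (a : 'M[R]_(m, n)) (b : 'M[R]_(n, p)) :
  `|a *m b| <= n%:R * (`|a| * `|b|).
Proof.
apply: mx_norm_le => [|i j]; first by rewrite !mulr_ge0.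
rewrite mxE (le_trans (ler_norm_sum _ _ _))//.
rewrite -[n in n%:R]card_ord mulr_natl -sumr_const ler_sum// => k _.
by rewrite normrM ler_pM// ler_mx_entry.
Qed.

Lemma norm_fixpoint_le m (x y : 'M[R]_(4, m)) d : `|d| <= 1 / 8 ->
  x = y + d *m x -> `|x| <= 2 * `|y|.
Proof.
move=> d8 xE; have := ler_normD y (d *m x); rewrite -xE.
have := mulmx_norm_le d x.
have : `|d| * `|x| <= 1 / 8 * `|x| by rewrite ler_wpM2r.
by move: (`|d| * `|x|) (`|d *m x|) (`|x|) (`|y|); clear => *; lra.
Qed.

Lemma near1_unit d : `|d| <= 1 / 8 -> 1 + d \in unitmx.
Proof.
move=> d8; rewrite -unitmx_tr -row_free_unit -kermx_eq0.
apply/eqP/row_matrixP => i.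
apply: trmx_inj; rewrite row0 trmx0; set v := row i _.
have : v *m (1 + d)^T = 0 by apply/sub_kermxP; exact: row_sub.
move=> /(congr1 trmx); rewrite trmx_mul trmxK trmx0 mulmxDl mul1mx => vd.
apply/eqP; rewrite -normr_le0.
have : v^T = 0 + (- d) *m v^T.
  by rewrite add0r mulNmx; apply/eqP; rewrite -subr_eq0 opprK vd.
move=> /(norm_fixpoint_le _); rewrite normrN normr0 mulr0; exact.
Qed.

(** Stochasticity phrased with a matrix product, so that it passes to
    inverses. *)
Lemma row_sums1P (a : 'M[R]_4) : (forall k, \sum_i a k i = 1) <->
  a *m const_mx 1 = const_mx 1 :> 'cV[R]_4.
Proof.
have E k : (a *m const_mx 1 : 'cV[R]_4) k 0 = \sum_i a k i.
  by rewrite mxE; apply: eq_bigr => i _; rewrite [const_mx _ _ _]mxE mulr1.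
split=> [a1|a1 k]; last by rewrite -E a1 mxE.
by apply/colP => k; rewrite E a1 mxE.
Qed.

End MatrixNorm.

(** * Supporting hyperplanes and convex combinations *)

Section Hyperplane.
Variables (R : realType) (n : nat).
Implicit Types (u x y z : 'rV[R]_n) (K : set 'rV[R]_n).

Definition dotp u x : R := \sum_i u 0 i * x 0 i.

Lemma dotp_is_scalar u : scalar (dotp u).
Proof.
move=> a x y; rewrite /dotp mulr_sumr -big_split; apply: eq_bigr => i _ /=.
by rewrite !mxE; ring.
Qed.

HB.instance Definition _ u :=
  GRing.isLinear.Build R 'rV[R]_n R *%R (dotp u) (dotp_is_scalar u).

Lemma dotpC u x : dotp u x = dotp x u.
Proof. by apply: eq_bigr => i _; rewrite mulrC. Qed.

Lemma dotp_gt0 u : u != 0 -> 0 < dotp u u.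
Proof.
move=> u0; rewrite lt_neqAle sumr_ge0 ?andbT; last first.
  by move=> i _; rewrite -expr2 sqr_ge0.
apply: contra u0; rewrite eq_sym psumr_eq0; last first.
  by move=> i _; rewrite -expr2 sqr_ge0.
move=> /allP u0; apply/eqP/rowP => i; rewrite mxE; apply/eqP.
by have := u0 i (mem_index_enum _); rewrite -expr2 sqrf_eq0.
Qed.

Lemma dotp_norm_le u x : `|dotp u x| <= n%:R * (`|u| * `|x|).
Proof.
rewrite (le_trans (ler_norm_sum _ _ _))//.
rewrite -[n in n%:R]card_ord mulr_natl -sumr_const ler_sum// => k _.
by rewrite normrM ler_pM// ler_mx_entry.
Qed.

Lemma scalarE (f : {scalar 'rV[R]_n}) x :
  f x = dotp (\row_i f (delta_mx 0 i)) x.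
Proof.
rewrite {1}(row_sum_delta x) linear_sum; apply: eq_bigr => i _.
by rewrite linearZ mxE mulrC.
Qed.

Lemma sum_continuous (F : 'I_n -> 'rV[R]_n -> R) :
  (forall i, continuous (F i)) -> continuous (fun x => \sum_i F i x).
Proof.
move=> cF x; apply: (continuous_big (op := +%R)) => [|i _]; last exact: cF.
exact: add_continuous.
Qed.

Lemma dotp_continuous u : continuous (dotp u).
Proof.
apply: sum_continuous => i x.
by apply: continuousM; [exact: cst_continuous|exact: coord_continuous].
Qed.

Lemma scalar_continuous (f : {scalar 'rV[R]_n}) : continuous f.
Proof.
rewrite (_ : f = dotp (\row_i f (delta_mx 0 i)) :> (_ -> _)).
  exact: dotp_continuous.
by apply/funext => x; exact: scalarE.
Qed.

Lemma convex_setP K : convex_set K <->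
  forall x y (t : R), K x -> K y -> 0 <= t <= 1 -> K (t *: x + (1 - t) *: y).
Proof.
split=> [cK x y t Kx Ky t01|cK x y t /set_mem Kx /set_mem Ky].
  have [t0 t1] := andP t01.
  by apply/set_mem; apply: (cK x y (Itv01 t0 t1)); exact/mem_set.
by apply/mem_set/cK => //; rewrite ge0 le1.
Qed.

(** The normal points from the point of K nearest to y towards y. *)
Lemma separating_hyperplane K y : compact K -> convex_set K -> K !=set0 ->
  ~ K y -> exists2 u, u != 0 & forall x, K x -> dotp u x <= dotp u y.
Proof.
move=> cK /convex_setP vK K0 Ky.
pose q x := dotp (x - y) (x - y).
have cq : continuous q.
  apply: sum_continuous => i x.
  have ci0 : {for x, continuous (fun x : 'rV[R]_n => (x - y) 0 i)}.
    rewrite (_ : (fun x => _) = (fun x : 'rV[R]_n => x 0 i - y 0 i)).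
      by apply: continuousB; [exact: coord_continuous|exact: cst_continuous].
    by apply/funext => z; rewrite !mxE.
  exact: (continuousM ci0 ci0).
have [z /set_mem Kz zmin] := EVT_min_rV K0 cK (continuous_subspaceT cq).
have zy : y - z != 0.
  by apply: contra_notN Ky; rewrite subr_eq0 => /eqP ->.
exists (y - z) => // x Kx.
rewrite -subr_ge0 -raddfB/=.
have -> : y - x = (y - z) - (x - z) by rewrite opprB addrA subrK.
rewrite raddfB/= subr_ge0 (le_trans _ (ltW (dotp_gt0 zy)))//.
rewrite leNgt; apply/negP => d0.
set d := dotp _ _ in d0; set m := dotp (x - z) (x - z).
have m0 : 0 < m.
  apply: dotp_gt0; apply: contraTneq d0.
  by rewrite /d => ->; rewrite raddf0 ltxx.
pose t := Num.min 1 (d / m).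
have t0 : 0 < t by rewrite lt_min ltr01 divr_gt0.
have t1 : t <= 1 by rewrite ge_min lexx.
have tm : t * m <= d.
  by rewrite -ler_pdivlMr// ge_min lexx orbT.
(* The point of the segment from z to x at parameter t is closer to y than z. *)
have := zmin (t *: x + (1 - t) *: z).
have Kt : K (t *: x + (1 - t) *: z) by apply: vK; rewrite ?(ltW t0).
move=> /(_ (mem_set Kt)); rewrite /q.
have -> : t *: x + (1 - t) *: z - y = t *: (x - z) - (y - z).
  by rewrite scalerBl scale1r scalerBr opprB; move: (t *: x) (t *: z) => a b;
    rewrite addrA addrAC addrA.
have -> : z - y = - (y - z) by rewrite opprB.
have qE : dotp (t *: (x - z) - (y - z)) (t *: (x - z) - (y - z)) =
    t * (t * m) - 2 * (t * d) + dotp (- (y - z)) (- (y - z)).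
  rewrite /m /d /dotp !mulr_sumr -sumrB -big_split; apply: eq_bigr => k _ /=.
  by rewrite !mxE; ring.
rewrite qE lerDr subr_ge0; apply/negP; rewrite -ltNge.
by nra.
Qed.

Lemma not_interior_near K p (e : R) : ~ K° p -> 0 < e ->
  exists2 y, ~ K y & `|y - p| < e.
Proof.
move=> Kp e0; apply: contrapT => nK; apply: Kp.
apply/nbhs_ballP; exists e => //= y; rewrite -ball_normE/= distrC => yp.
by apply: contrapT => Ky; apply: nK; exists y.
Qed.

Lemma compact_unit_sphere : compact [set u : 'rV[R]_n | `|u| = 1].
Proof.
apply: bounded_closed_compact.
  by exists 1; split => // x x1 u /= ->; exact: ltW.
have -> : [set u : 'rV[R]_n | `|u| = 1] = Num.norm @^-1` [set 1] by [].
by apply: closed_comp => [x _|]; [exact: norm_continuous|exact: closed_eq].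
Qed.

(** A point p outside the interior of K is a limit of points outside K, each of
    which is separated from K by a unit normal; a cluster point of these
    normals supports K at p. The set S e collects the unit normals that support
    K at p up to an error e. *)
Lemma supporting_hyperplane K p : compact K -> convex_set K -> K !=set0 ->
  ~ K° p -> exists2 u, u != 0 & forall x, K x -> dotp u x <= dotp u p.
Proof.
move=> cK vK K0 Kp.
pose S (e : R) := [set u : 'rV[R]_n | `|u| = 1 /\
  forall x, K x -> dotp u (x - p) <= e].
have S_nonempty e : 0 < e -> S e !=set0.
  move=> e0.
  have d0 : 0 < e / (n%:R + 1) by rewrite divr_gt0// ltr_wpDl.
  have [y Ky yp] := not_interior_near Kp d0.
  have [u u0 uK] := separating_hyperplane cK vK K0 Ky.
  have nu : 0 < `|u| by rewrite normr_gt0.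
  exists (`|u|^-1 *: u); split.
    by rewrite normrZ normfV normr_id mulVf// gt_eqF.
  move=> x Kx; have := uK x Kx; set v := `|u|^-1 *: u => ux.
  have vE z : dotp v z = `|u|^-1 * dotp u z.
    by rewrite dotpC linearZ/= dotpC.
  have nv : `|v| = 1 by rewrite normrZ normfV normr_id mulVf// gt_eqF.
  have -> : x - p = (x - y) + (y - p) by rewrite addrA subrK.
  rewrite raddfD/= -[e]add0r lerD//.
    by rewrite vE pmulr_rle0 ?invr_gt0// raddfB/= subr_le0.
  rewrite (le_trans (ler_norm _))// (le_trans (dotp_norm_le _ _))// nv mul1r.
  apply: (@le_trans _ _ (n%:R * (e / (n%:R + 1)))).
    by rewrite ler_wpM2l// ltW.
  by rewrite mulrCA ger_pMr// ler_pdivrMr ?ltr_wpDl// mul1r lerDl.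
pose F := filter_from [set e : R | 0 < e] S.
have FF : ProperFilter F.
  apply: filter_from_proper => //; apply: filter_from_filter.
    by exists 1 => /=.
  move=> e f /= e0 f0; exists (Num.min e f); first by rewrite /= lt_min e0.
  move=> u [u1 uK]; split; split=> // x /uK;
    by rewrite le_min => /andP[].
have FS : F [set u | `|u| = 1] by exists 1; [exact: ltr01|move=> u []].
have [u [/= u1]] := compact_unit_sphere FF FS.
rewrite clusterE => uF.
exists u => [|x Kx].
  by rewrite -normr_eq0 u1 oner_eq0.
rewrite -subr_le0 -raddfB/=; apply/ler_addgt0Pr => e e0; rewrite add0r.
have cl : closed [set v : 'rV[R]_n | dotp v (x - p) <= e].
  have -> : [set v | dotp v (x - p) <= e] =
      (dotp (x - p)) @^-1` [set y | y <= e].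
    by apply/seteqP; split=> v /=; rewrite dotpC.
  by apply: closed_comp => [v _|]; [exact: dotp_continuous|exact: closed_le].
suff : closure [set v : 'rV[R]_n | dotp v (x - p) <= e] u.
  by rewrite -((closure_id _).1 cl).
by apply: uF; exists e => // v [_ uK]; exact: uK.
Qed.

End Hyperplane.

Lemma convex_comb (R : realType) m n (K : set 'rV[R]_m) (c : 'I_n -> R)
    (x : 'I_n -> 'rV[R]_m) : convex_set K ->
  (forall i, 0 <= c i) -> \sum_i c i = 1 -> (forall i, K (x i)) ->
  K (\sum_i c i *: x i).
Proof.
move=> /convex_setP cK; elim: n => [|n IH] in c x *.
  by move=> _; rewrite big_ord0 => /esym/eqP; rewrite oner_eq0.
move=> c0; rewrite !big_ord_recr /=; set t := \sum_(i < n) _ => c1 Kx.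
have t0 : 0 <= t by rewrite sumr_ge0.
have cl : c ord_max = 1 - t by rewrite -c1 addrAC subrr add0r.
have [t_eq0|t_neq0] := eqVneq t 0.
  have cz i : c (widen_ord (leqnSn n) i) = 0.
    apply/eqP; move/eqP: t_eq0; rewrite psumr_eq0//.
    by move=> /allP/(_ i (mem_index_enum _)).
  rewrite big1 => [|i _]; last by rewrite cz scale0r.
  by rewrite cl t_eq0 subr0 scale1r add0r.
have -> : \sum_(i < n) c (widen_ord (leqnSn n) i) *: x (widen_ord (leqnSn n) i)
    = t *: \sum_(i < n) (c (widen_ord (leqnSn n) i) / t) *:
        x (widen_ord (leqnSn n) i).
  rewrite scaler_sumr; apply: eq_bigr => i _.
  by rewrite scalerA mulrCA mulfV// mulr1.
have t1 : t <= 1 by rewrite -subr_ge0 -cl.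
rewrite cl; apply: cK; [|exact: Kx|exact/andP].
apply: IH => //.
  by move=> i; apply: divr_ge0.
by rewrite -mulr_suml mulfV.
Qed.

(** * Widths of compact sets *)

Section Width.
Variables (R : realType) (n : nat).
Implicit Types (K L : set 'rV[R]_n) (f : {scalar 'rV[R]_n}).

Lemma has_sup_image K f : compact K -> K !=set0 -> has_sup (f @` K).
Proof.
move=> cK K0; apply: compact_has_sup; first exact: image_nonempty.
apply: continuous_compact => //; apply: continuous_subspaceT.
exact: scalar_continuous.
Qed.

Lemma has_inf_image K f : compact K -> K !=set0 -> has_inf (f @` K).
Proof.
move=> cK K0; split; first exact: image_nonempty.
have cf : {within K, continuous f}.
  by apply: continuous_subspaceT; exact: scalar_continuous.
have [y _ ymin] := EVT_min_rV K0 cK cf.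
by exists (f y) => _ [z Kz <-]; apply: ymin; exact/mem_set.
Qed.

Lemma le_width K f x y : compact K -> K x -> K y -> f x - f y <= width K f.
Proof.
move=> cK Kx Ky; have K0 : K !=set0 by exists x.
rewrite lerB//.
  by apply: sup_upper_bound; [exact: has_sup_image|exists x].
by apply: ge_inf; [have [] := has_inf_image f cK K0|exists y].
Qed.

Lemma width_attained K f : compact K -> K !=set0 ->
  exists x y, [/\ K x, K y & width K f = f x - f y].
Proof.
move=> cK K0.
have cf : {within K, continuous f}.
  by apply: continuous_subspaceT; exact: scalar_continuous.
have [x /set_mem Kx xmax] := EVT_max_rV K0 cK cf.
have [y /set_mem Ky ymin] := EVT_min_rV K0 cK cf.
exists x, y; split=> //; apply/le_anti; rewrite le_width// andbT lerB//.
  apply: ge_sup; first exact: image_nonempty.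
  by move=> _ [z Kz <-]; apply: xmax; exact/mem_set.
apply: lb_le_inf; first exact: image_nonempty.
by move=> _ [z Kz <-]; apply: ymin; exact/mem_set.
Qed.

(** Widths are nonnegative, so the infimum defining the lattice width is a
    genuine lower bound. *)
Lemma lattice_width_le L K f : compact K -> K !=set0 ->
  dual_lattice (linear_lattice L) f -> (exists x, f x != 0) ->
  lattice_width L K <= width K f.
Proof.
move=> cK K0 Lf f0; apply: ge_inf; last by exists f.
exists 0 => _ [g _ <-]; have [x Kx] := K0.
by rewrite -(subrr (g x)) le_width.
Qed.

End Width.

(** * The circulant data of the tetrahedron *)

Section Circulant.
Variable R : realType.
Implicit Types (a b w : 'M[R]_4) (t : seq R).

Definition circ t : 'M[R]_4 := \matrix_(i < 4, j < 4) t`_(j - i)%R.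

Lemma circE t :
  (((circ t o0 o0 = t`_0) * (circ t o0 o1 = t`_1) *
    (circ t o0 o2 = t`_2) * (circ t o0 o3 = t`_3)) *
   ((circ t o1 o0 = t`_3) * (circ t o1 o1 = t`_0) *
    (circ t o1 o2 = t`_1) * (circ t o1 o3 = t`_2)) *
   ((circ t o2 o0 = t`_2) * (circ t o2 o1 = t`_3) *
    (circ t o2 o2 = t`_0) * (circ t o2 o3 = t`_1)) *
   ((circ t o3 o0 = t`_1) * (circ t o3 o1 = t`_2) *
    (circ t o3 o2 = t`_3) * (circ t o3 o3 = t`_0)))%type.
Proof. by do ![split]; rewrite mxE. Qed.

Notation s := (Num.sqrt 2 : R).

Lemma s_sqr : s ^+ 2 = 2.
Proof. by rewrite sqr_sqrtr. Qed.

Lemma s_bounds : 41 / 29 < s < 99 / 70.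
Proof.
have s0 : 0 <= s by rewrite sqrtr_ge0.
have := s_sqr; rewrite expr2 => s2; apply/andP; split; nra.
Qed.

(** Row i: the barycentric coordinates in Delta of the lattice point on the
    facet opposite to vertex i. *)
Definition contact : 'M[R]_4 := circ [:: 0; 1 / 4; s / 4; (3 - s) / 4].

(** Row j: the values at the four vertices of Delta of the dual functional
    attached to the edge from vertex j to vertex j + 1, divided by 2 + s and
    shifted so as to range from 1 at vertex j to 0 at vertex j + 1. *)
Definition side_form : 'M[R]_4 := circ [:: 1; 0; s / 2; s / 2].

(** The same for the edge from vertex j to vertex j + 2; each of the two edges
    of this kind occurs twice, with opposite orientations. *)
Definition diag_form : 'M[R]_4 := circ [:: 1; 1 - s / 2; 0; s / 2].

(** When the rows of [a] are the barycentric coordinates in Delta of the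
    vertices of a tetrahedron T, this is the drop of the affine form with vertex
    values [f j] along the edge of T from vertex j to vertex j + d. *)
Definition edge_width (f : 'M[R]_4) (d : 'I_4) a (j : 'I_4) : R :=
  \sum_k f j k * (a j k - a (j + d) k).

(** The first order optimality condition. Its weights are positive, and
    tr(P w) measures how the facets move away from the contact points, so no
    first order motion that keeps the contact points on the facets increases
    all six drops. *)
Lemma edge_width_multipliers w : (forall i, \sum_j w i j = 0) ->
  (2 - s) / 4 * (\sum_j edge_width side_form 1 w j)
    + (s - 1) / 4 * (\sum_j edge_width diag_form 2 w j)
  = - \tr (contact *m w).
Proof.
move=> w1.
have := w1 o0; have := w1 o1; have := w1 o2; have := w1 o3.
rewrite !sum4 => e3 e2 e1 e0.
have d0 : w o0 o0 = - (w o0 o1 + w o0 o2 + w o0 o3) by lra.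
have d1 : w o1 o1 = - (w o1 o0 + w o1 o2 + w o1 o3) by lra.
have d2 : w o2 o2 = - (w o2 o0 + w o2 o1 + w o2 o3) by lra.
have d3 : w o3 o3 = - (w o3 o0 + w o3 o1 + w o3 o2) by lra.
rewrite /edge_width /mxtrace !sum4 ![(_ *m _) _ _]mxE !sum4.
rewrite !ord4D !circE /= d0 d1 d2 d3.
by field: s_sqr.
Qed.

(** The linear forms by which the drops have to be multiplied in
    [second_order_identity]. Their coefficients solve the linear system that
    identity amounts to, and are not unique. *)
Definition side_coef a j : R :=
  (17 / 6 * s - 41 / 8) * a j (j + 1)
  + (131 / 12 - 25 / 3 * s) * a (j + 1) (j + 2)
  + (13 / 3 - 43 / 12 * s) * a (j + 2) (j + 3)
  + (15 / 2 * s - 253 / 24) * a (j + 3) j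
  + (7 / 4 * s - 15 / 8) * a j (j + 2)
  - (1 / 8 + s / 4) * a (j + 1) (j + 3)
  + (11 / 4 - 5 / 4 * s) * a (j + 2) j.

Definition diag_coef a j : R := (s / 6 - 13 / 12) * a j (j + 1).

(** On the kernel of the drops, the trace form is positive definite. A quadratic
    form that vanishes on the kernel of some linear forms is a combination of
    these with linear coefficients; applied to the difference between the trace
    form and a positive form agreeing with it on the kernel, this gives the
    identity. The weights on the right-hand side are positive, the last one
    because s < 13/9. *)
Lemma second_order_identity b : (forall i, \sum_j b i j = 0) ->
  (forall i, (contact *m b) i i = 0) ->
  \tr (contact *m b *m b) + \sum_j edge_width side_form 1 b j * side_coef b j
    + \sum_j edge_width diag_form 2 b j * diag_coef b j
  = (6 * s - 47 / 6) * (\sum_j (b j (j + 1)) ^+ 2)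
    + 1 / 2 * (\sum_j (b j (j + 2)) ^+ 2)
    + (13 / 12 - 3 / 4 * s) * (\sum_j b j (j + 1)) ^+ 2.
Proof.
move=> b1 Pb.
have := b1 o0; have := b1 o1; have := b1 o2; have := b1 o3.
rewrite !sum4 => e3 e2 e1 e0.
have d0 : b o0 o0 = - (b o0 o1 + b o0 o2 + b o0 o3) by lra.
have d1 : b o1 o1 = - (b o1 o0 + b o1 o2 + b o1 o3) by lra.
have d2 : b o2 o2 = - (b o2 o0 + b o2 o1 + b o2 o3) by lra.
have d3 : b o3 o3 = - (b o3 o0 + b o3 o1 + b o3 o2) by lra.
have := Pb o0; have := Pb o1; have := Pb o2; have := Pb o3.
rewrite ![(_ *m _) _ _]mxE !sum4 !circE /= => f3 f2 f1 f0.
have g0 : b o1 o0 = - (s * b o2 o0 + (3 - s) * b o3 o0) by lra.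
have g1 : b o2 o1 = - (s * b o3 o1 + (3 - s) * b o0 o1) by lra.
have g2 : b o3 o2 = - (s * b o0 o2 + (3 - s) * b o1 o2) by lra.
have g3 : b o0 o3 = - (s * b o1 o3 + (3 - s) * b o2 o3) by lra.
rewrite -mulmxA /mxtrace /edge_width /side_coef /diag_coef !sum4.
rewrite ![(contact *m _) _ _]mxE !sum4 ![(b *m _) _ _]mxE !sum4.
rewrite !ord4D !circE /= d0 d1 d2 d3 g0 g1 g2 g3.
by field: s_sqr.
Qed.

(** * Rigidity of the tetrahedron *)

Implicit Types c : 'M[R]_4.
Notation side_width := (edge_width side_form 1).
Notation diag_width := (edge_width diag_form 2).

Lemma edge_widthD f d a c j :
  edge_width f d (a + c) j = edge_width f d a j + edge_width f d c j.
Proof.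
by rewrite /edge_width -big_split; apply: eq_bigr => k _; rewrite !mxE/=; ring.
Qed.

Lemma edge_width_le f d a j :
  `|edge_width f d a j| <= (\sum_k `|f j k|) * (2 * `|a|).
Proof.
rewrite (le_trans (ler_norm_sum _ _ _))// mulr_suml ler_sum// => k _.
rewrite normrM ler_wpM2l// (le_trans (ler_normB _ _))//.
by have := ler_mx_entry a j k; have := ler_mx_entry a (j + d) k; lra.
Qed.

Lemma side_form_sum j : \sum_k `|side_form j k| <= 3.
Proof.
have /andP[s1 s2] := s_bounds.
have h0 : `|s / 2| = s / 2 by rewrite ger0_norm; lra.
by move: j; apply: forall4; rewrite sum4 !circE /= normr0 normr1 h0; lra.
Qed.

Lemma diag_form_sum j : \sum_k `|diag_form j k| <= 3.
Proof.
have /andP[s1 s2] := s_bounds.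
have h0 : `|s / 2| = s / 2 by rewrite ger0_norm; lra.
have h1 : `|1 - s / 2| = 1 - s / 2 by rewrite ger0_norm; lra.
by move: j; apply: forall4; rewrite sum4 !circE /= normr0 normr1 h0 h1; lra.
Qed.

Lemma side_width_le a j : `|side_width a j| <= 6 * `|a|.
Proof.
rewrite (le_trans (edge_width_le _ _ _ _))// mulrA ler_wpM2r//.
by have := side_form_sum j; lra.
Qed.

Lemma diag_width_le a j : `|diag_width a j| <= 6 * `|a|.
Proof.
rewrite (le_trans (edge_width_le _ _ _ _))// mulrA ler_wpM2r//.
by have := diag_form_sum j; lra.
Qed.

Lemma side_coef_le a j : `|side_coef a j| <= 5 * `|a|.
Proof.
have /andP[s1 s2] := s_bounds.
have A0 := normr_ge0 a.
have term (c d : R) i k : - d <= c <= d ->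
    - (d * `|a|) <= c * a i k <= d * `|a|.
  rewrite -!ler_norml normrM => cd.
  by apply: ler_pM => //; exact: ler_mx_entry.
rewrite /side_coef; move: (s) s1 s2 => v s1 s2.
have := term (17 / 6 * v - 41 / 8) (9 / 8) j (j + 1).
have := term (131 / 12 - 25 / 3 * v) (7 / 8) (j + 1) (j + 2).
have := term (13 / 3 - 43 / 12 * v) (3 / 4) (j + 2) (j + 3).
have := term (15 / 2 * v - 253 / 24) (1 / 12) (j + 3) j.
have := term (7 / 4 * v - 15 / 8) (5 / 8) j (j + 2).
have := term (1 / 8 + v / 4) (1 / 2) (j + 1) (j + 3).
have := term (11 / 4 - 5 / 4 * v) 1 (j + 2) j.
move=> {term}.
do 7 (case/(_ _)/andP; [lra|move=> ? ?]).
by rewrite ler_norml; lra.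
Qed.

Lemma diag_coef_le a j : `|diag_coef a j| <= `|a|.
Proof.
have /andP[s1 s2] := s_bounds.
rewrite /diag_coef normrM; have := ler_mx_entry a j (j + 1).
have : `|s / 6 - 13 / 12| <= 1 by rewrite ler0_norm; lra.
by have := normr_ge0 (a j (j + 1)); nra.
Qed.

Lemma contact_ge0 i k : 0 <= contact i k.
Proof.
have /andP[s1 s2] := s_bounds.
have h1 : 0 <= s / 4 by lra.
have h2 : 0 <= (3 - s) / 4 by lra.
have h3 : 0 <= 1 / 4 :> R by lra.
by move: i k; do 2 apply: forall4; rewrite !circE.
Qed.

Lemma contact_sum i : \sum_k contact i k = 1.
Proof. by move: i; apply: forall4; rewrite sum4 !circE /=; field. Qed.

Lemma trace_contact_le a : `|\tr (contact *m a)| <= 4 * `|a|.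
Proof.
rewrite /mxtrace (le_trans (ler_norm_sum _ _ _))//.
suff B i : `|(contact *m a) i i| <= `|a|.
  rewrite (le_trans (ler_sum _ (fun i _ => B i)))//.
  by rewrite sumr_const card_ord mulr_natl.
rewrite mxE (le_trans (ler_norm_sum _ _ _))//.
rewrite -[leRHS]mul1r -(contact_sum i) mulr_suml ler_sum// => k _.
rewrite normrM ger0_norm ?contact_ge0// ler_wpM2l ?contact_ge0//.
exact: ler_mx_entry.
Qed.

(** The contact condition expresses the entries at (j + 1, j) through the ones
    at distances 1 and 2, and the zero row sums then give the diagonal; so the
    positive form of [second_order_identity] controls the whole matrix. *)
Lemma norm_le_steps b : (forall i, \sum_j b i j = 0) ->
  (forall i, (contact *m b) i i = 0) ->
  `|b| ^+ 2 <= 25 * (\sum_j (b j (j + 1)) ^+ 2 + \sum_j (b j (j + 2)) ^+ 2).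
Proof.
move=> b1 Pb; set N := _ + _.
have sum0 (F : 'I_4 -> R) : 0 <= \sum_k (F k) ^+ 2.
  by rewrite sumr_ge0// => k _; rewrite sqr_ge0.
have term (F : 'I_4 -> R) j : (F j) ^+ 2 <= \sum_k (F k) ^+ 2.
  by rewrite (bigD1 j)//= lerDl sumr_ge0// => k _; rewrite sqr_ge0.
have N0 : 0 <= N by rewrite addr_ge0.
pose M := Num.sqrt N; have M0 : 0 <= M by rewrite sqrtr_ge0.
suff bM : `|b| <= 5 * M.
  rewrite -(sqr_sqrtr N0) -/M; have := normr_ge0 b.
  by move: (`|b|) bM => x; clear - M0 => ? ?; nra.
have sq x : x ^+ 2 <= N -> `|x| <= M.
  by move=> xN; rewrite -sqrtr_sqr ler_wsqrtr.
have S1 j : `|b j (j + 1)| <= M.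
  apply: sq; rewrite (le_trans (term (fun j => b j (j + 1)) j))//.
  by rewrite lerDl sum0.
have S2 j : `|b j (j + 2)| <= M.
  apply: sq; rewrite (le_trans (term (fun j => b j (j + 2)) j))//.
  by rewrite lerDr sum0.
have S3' j : `|b (j + 1) j| <= 3 * M.
  have := Pb j; rewrite mxE (sum4_from _ j).
  have -> : contact j j = 0 by move: j; apply: forall4; rewrite circE.
  have -> : contact j (j + 1) = 1 / 4.
    by move: j; apply: forall4; rewrite ord4D circE.
  have -> : contact j (j + 2) = s / 4.
    by move: j; apply: forall4; rewrite ord4D circE.
  have -> : contact j (j + 3) = (3 - s) / 4.
    by move: j; apply: forall4; rewrite ord4D circE.
  have := S1 (j + 3); have := S2 (j + 2).
  have -> : j + 2 + 2 = j by move: j; apply: forall4; rewrite !ord4D.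
  have -> : j + 3 + 1 = j by move: j; apply: forall4; rewrite !ord4D.
  move: (b (j + 1) j) (b (j + 2) j) (b (j + 3) j) => x y z.
  have /andP[s1 s2] := s_bounds; move: (s) s1 s2 => v v1 v2.
  clear - M0 v1 v2; rewrite !ler_norml => /andP[? ?] /andP[? ?] E.
  have {E} -> : x = - (v * y + (3 - v) * z) by lra.
  by apply/andP; split; nra.
have S3 j : `|b j (j + 3)| <= 3 * M.
  have := S3' (j + 3).
  by have -> : j + 3 + 1 = j by move: j; apply: forall4; rewrite !ord4D.
apply: mx_norm_le => [|i]; first by rewrite mulr_ge0.
apply: (@ord4_cases i).
- have := b1 i; rewrite (sum4_from _ i).
  move: (S1 i) (S2 i) (S3 i).
  move: (b i i) (b i (i + 1)) (b i (i + 2)) (b i (i + 3)) => x y z u.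
  clear - M0; rewrite !ler_norml => /andP[? ?] /andP[? ?] /andP[? ?] ?; lra.
- by apply: le_trans (S1 i) _; clear - M0; lra.
- by apply: le_trans (S2 i) _; clear - M0; lra.
- by apply: le_trans (S3 i) _; clear - M0; lra.
Qed.

(** With e the bound on b and w, the error terms are at most 640 e |b|^2 in
    total, while the second order gain is at least |b|^2 / 50; any e below
    1/32000 would do. *)
Lemma rigidity b w : `|b| <= 1 / 40 / 40 / 40 -> `|w| <= 1 / 40 / 40 / 40 ->
  (forall i, \sum_j b i j = 0) -> (forall i, \sum_j w i j = 0) ->
  (forall i, (contact *m b) i i = 0) ->
  b + w + b *m w = 0 ->
  (forall j, 0 <= side_width w j) -> (forall j, 0 <= diag_width w j) ->
  b = 0.
Proof.
set e : R := 1 / 40 / 40 / 40.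
move=> be we b1 w1 Pb bw sw dw.
have e0 : 0 <= e by rewrite /e; lra.
have B0 := normr_ge0 b.
have bwn : `|b *m w| <= 4 * e * `|b|.
  by rewrite (le_trans (mulmx_norm_le _ _))// -mulrA ler_pM2l// mulrC ler_wpM2r.
have bbn : `|b *m b| <= 4 * `|b| ^+ 2 by rewrite expr2 mulmx_norm_le.
have bbwn : `|b *m b *m w| <= 16 * e * `|b| ^+ 2.
  rewrite (le_trans (mulmx_norm_le _ _))//.
  have -> : 16 * e * `|b| ^+ 2 = 4 * ((4 * `|b| ^+ 2) * e) by ring.
  by rewrite ler_pM2l// ler_pM.
have trE : \tr (contact *m w) =
    \tr (contact *m b *m b) + \tr (contact *m (b *m b *m w)).
  have wE : w = - b - b *m w.
    by apply/eqP; rewrite -subr_eq0 opprD !opprK addrA [w + b]addrC bw.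
  have trb : \tr (contact *m b) = 0 by rewrite /mxtrace big1.
  rewrite {1}wE mulmxBr mulmxN raddfB raddfN /= trb oppr0 sub0r.
  rewrite {1}wE mulmxBr mulmxN mulmxBr mulmxN raddfB raddfN /=.
  by rewrite !mulmxA; ring.
have width0 f d j : edge_width f d (0 : 'M[R]_4) j = 0.
  by rewrite /edge_width big1// => k _; rewrite !mxE subrr mulr0.
have widthb f d j :
    edge_width f d b j = - (edge_width f d w j + edge_width f d (b *m w) j).
  have := edge_widthD f d (b + w) (b *m w) j; rewrite bw edge_widthD width0.
  by lra.
(* The drop of b is minus the sum of those of w and of b w. So its product with
   a small form splits into a part that the multipliers absorb, the drop of w
   being nonnegative, and a part of third order. *)
have absorb f d (c : 'I_4 -> R) m : 0 <= m ->
    (forall j, 0 <= edge_width f d w j) ->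
    (forall j, `|edge_width f d (b *m w) j| <= 6 * `|b *m w|) ->
    (forall j, `|c j| <= m * `|b|) ->
    \sum_j edge_width f d b j * c j <=
      m * e * (\sum_j edge_width f d w j) + 96 * m * e * `|b| ^+ 2.
  move=> m0 Ww Wbw cm.
  have -> : 96 * m * e * `|b| ^+ 2 = \sum_(j < 4) (24 * m * e * `|b| ^+ 2).
    by rewrite sumr_const card_ord -mulr_natl; ring.
  rewrite mulr_sumr -big_split ler_sum//= => j _; rewrite widthb.
  have p1 : - (edge_width f d w j * c j) <= edge_width f d w j * (m * e).
    rewrite -mulrN ler_wpM2l// (le_trans (ler_norm _))// normrN.
    rewrite (le_trans (cm j))//.
    by rewrite ler_wpM2l.
  have p2 : - (edge_width f d (b *m w) j * c j) <=
      6 * (4 * e * `|b|) * (m * `|b|).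
    rewrite (le_trans (ler_norm _))// normrN normrM ler_pM//.
    by rewrite (le_trans (Wbw j))// ler_pM2l.
  move: p1 p2; move: (edge_width f d w j) (edge_width f d (b *m w) j) (c j).
  by move: (`|b|) => x y z u; clear; rewrite expr2 => ? ?; nra.
have p1 := absorb _ _ (side_coef b) 5 (ler0n _ _) sw
  (side_width_le _) (side_coef_le b).
have p2 : \sum_j diag_width b j * diag_coef b j <=
      1 * e * (\sum_j diag_width w j) + 96 * 1 * e * `|b| ^+ 2.
  apply: absorb => //; first exact: diag_width_le.
  by move=> j; rewrite mul1r diag_coef_le.
have p3 := trace_contact_le (b *m b *m w).
have p4 := second_order_identity b1 Pb.
have p5 := edge_width_multipliers w1.
have p6 := norm_le_steps b1 Pb.
have sw0 : 0 <= \sum_j side_width w j by rewrite sumr_ge0.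
have dw0 : 0 <= \sum_j diag_width w j by rewrite sumr_ge0.
have q1 : 0 <= \sum_j b j (j + 1) ^+ 2.
  by rewrite sumr_ge0// => j _; rewrite sqr_ge0.
have q2 : 0 <= (\sum_j b j (j + 1)) ^+ 2 by rewrite sqr_ge0.
have /andP[s1 s2] := s_bounds.
apply/eqP; rewrite -normr_eq0; apply/eqP.
move: p3 p4 p5; rewrite trE mulmxA ler_norml => /andP[p3 _].
move: bbwn p1 p2 p6 sw0 dw0 q1 q2 p3 s1 s2.
move: (\tr _) (\tr _) (`|b *m b *m w|) => t1 t2 nbb.
move: (\sum_j side_width w j) (\sum_j diag_width w j) => SW DW.
move: (\sum_j side_width b j * _) (\sum_j diag_width b j * _) => SC DC.
move: (\sum_j _ ^+ 2) (\sum_j _ ^+ 2) ((\sum_j _) ^+ 2) => Y X Z.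
move: (s) (`|b|) B0 => v x x0; clear - e e0 x0.
(* From here on only scalars remain: SW and DW are the sums of the drops of w, x
   is the norm of b, and the conclusion is linear in the listed products. *)
have eE : e = 1 / 40 / 40 / 40 by [].
move: (e) e0 eE => h h0 hE *.
have sw1 : 0 <= ((2 - v) / 4 - 5 * h) * SW by rewrite mulr_ge0//; lra.
have dw1 : 0 <= ((v - 1) / 4 - h) * DW by rewrite mulr_ge0//; lra.
have X1 : 0 <= (6 * v - 47 / 6 - 1 / 2) * X by rewrite mulr_ge0//; lra.
have Z1 : 0 <= (13 / 12 - 3 / 4 * v) * Z by rewrite mulr_ge0//; lra.
have x2 : x ^+ 2 <= 0 by subst h; lra.
by have := sqr_ge0 x => x2'; apply/eqP; rewrite -sqrf_eq0 eq_le x2 x2'.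
Qed.

End Circulant.

(** * Barycentric coordinates and the shape of Delta *)

Section Tetrahedron.
Variable R : realType.
Implicit Types (x y : 'rV[R]_3) (i j k : 'I_4).
Notation s := (Num.sqrt 2 : R).

Lemma vec3E (a b c : R) : (vec3 a b c 0 k0 = a) * (vec3 a b c 0 k1 = b) *
  (vec3 a b c 0 k2 = c).
Proof. by rewrite !mxE. Qed.

Definition vertex i : 'rV[R]_3 :=
  [:: vec3 (2 + s) s (2 + s); vec3 (- s) (2 + s) (- 2 - s);
      vec3 (- 2 - s) (- s) (2 + s); vec3 s (- 2 - s) (- 2 - s)]`_i.

(** Inner normals of the facets, scaled so that [bary] is 1 at the opposite
    vertex. *)
Definition normal i : 'rV[R]_3 :=
  [:: vec3 (1 / 8) ((s - 1) / 8) ((2 - s) / 8);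
      vec3 ((1 - s) / 8) (1 / 8) ((s - 2) / 8);
      vec3 (- 1 / 8) ((1 - s) / 8) ((2 - s) / 8);
      vec3 ((s - 1) / 8) (- 1 / 8) ((s - 2) / 8)]`_i.

Definition bary x i : R := dotp (normal i) x + 1 / 4.

Lemma baryE x i : bary x i = normal i 0 k0 * x 0 k0 + normal i 0 k1 * x 0 k1
  + normal i 0 k2 * x 0 k2 + 1 / 4.
Proof. by rewrite /bary /dotp sum3. Qed.

Lemma bary_sum x : \sum_i bary x i = 1.
Proof. by rewrite sum4 !baryE /normal /= !vec3E; field. Qed.

Lemma bary_comb x : \sum_i bary x i *: vertex i = x.
Proof.
by apply: row3P; rewrite sum4 !mxE !baryE /normal /vertex /= !vec3E;
  field: (s_sqr R).
Qed.

Lemma bary_vertex i k : bary (vertex i) k = (i == k)%:R.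
Proof.
by move: i k; do 2 apply: forall4; rewrite baryE /normal /vertex /= !vec3E /=;
  field: (s_sqr R).
Qed.

Lemma bary_conv x y (t : R) i :
  bary (t *: x + (1 - t) *: y) i = t * bary x i + (1 - t) * bary y i.
Proof. by rewrite /bary raddfD /= !linearZ /=; ring. Qed.

Lemma bary_inj x y : (forall i, bary x i = bary y i) -> x = y.
Proof.
by move=> xy; rewrite -(bary_comb x) -(bary_comb y);
  apply: eq_bigr => i _; rewrite xy.
Qed.

Lemma bary_dotp u x p :
  \sum_k dotp u (p - vertex k) * bary x k = dotp u (p - x).
Proof.
have -> : dotp u (p - x) = dotp u p - \sum_k dotp u (vertex k) * bary x k.
  rewrite raddfB /= -{1}(bary_comb x); congr (_ - _).
  rewrite (linear_sum (dotp u)) /=; apply: eq_bigr => k _.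
  by rewrite linearZ /= mulrC.
under eq_bigr => k _ do rewrite raddfB /= mulrBl.
by rewrite sumrB -mulr_sumr bary_sum mulr1.
Qed.

Lemma bary_continuous i : continuous (bary ^~ i).
Proof.
by move=> x; apply: continuousD; [exact: dotp_continuous|exact: cst_continuous].
Qed.

Lemma near_bary_gt x (c : R) :
  (forall i, c < bary x i) -> nbhs x [set y | forall i, c < bary y i].
Proof.
move=> cx; apply: (@filter_forall _ _ (fun i y => c < bary y i) (nbhs x)) => i.
have := @bary_continuous i x; rewrite /continuous_at => bc.
exact: (cvgr_gt _ bc _ (cx i)).
Qed.

Lemma convex_bary_ge (c : R) : convex_set [set x | forall i, c <= bary x i].
Proof.
apply/convex_setP => x y t /= xc yc /andP[t0 t1] i; rewrite bary_conv.
have -> : c = t * c + (1 - t) * c by ring.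
by rewrite lerD// ler_wpM2l// subr_ge0.
Qed.

Lemma DeltaP : @Delta R = [set x | forall i, 0 <= bary x i].
Proof.
have V i : [set x | forall i, 0 <= bary x i] (vertex i).
  by move=> k; rewrite bary_vertex ler0n.
apply/seteqP; split.
  apply: smallest_sub; first exact: convex_bary_ge.
  by move=> y [[[->|->]|->]|->]; [exact: (V o0)|exact: (V o1)|exact: (V o2)|
    exact: (V o3)].
move=> x x0 C [cC vC]; rewrite -(bary_comb x); apply: convex_comb => //.
  exact: bary_sum.
by apply: forall4; apply: vC;
  [left; left; left|left; left; right|left; right|right].
Qed.

Lemma vertex_Delta i : @Delta R (vertex i).
Proof. by rewrite DeltaP => k; rewrite bary_vertex ler0n. Qed.

(** Moving a point of a facet outwards along the normal leaves Delta. *)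
Lemma Delta_interior x : (@Delta R)° x -> forall i, 0 < bary x i.
Proof.
move=> Dx i; rewrite ltNge; apply/negP => xi.
have v0 : 0 < dotp (normal i) (normal i).
  apply: dotp_gt0; move: i {xi}; apply: forall4; apply/eqP => /rowP n0;
    [have := n0 k0|have := n0 k1|have := n0 k0|have := n0 k1];
    by rewrite /normal /= vec3E mxE; lra.
have [e /= e0 De] := (nbhs_ballP _ _).1 Dx.
pose t := e / (1 + `|normal i|).
have t0 : 0 < t by rewrite divr_gt0// ltr_pwDl.
have : (@Delta R) (x - t *: normal i).
  apply: De; rewrite -ball_normE /= opprB addrC subrK normrZ gtr0_norm//.
  by rewrite /t -mulrA gtr_pMr// mulrC ltr_pdivrMr ?ltr_pwDl// mul1r ltrDr.
rewrite DeltaP => /(_ i); rewrite /= leNgt => /negP; apply.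
have -> : bary (x - t *: normal i) i =
    bary x i - t * dotp (normal i) (normal i).
  by rewrite /bary raddfB /= linearZ /=; ring.
by rewrite subr_lt0 (le_lt_trans xi)// mulr_gt0.
Qed.

Lemma compact_Delta : compact (@Delta R).
Proof.
apply: bounded_closed_compact; last first.
  have -> : @Delta R = \bigcap_i (bary ^~ i @^-1` [set y | 0 <= y]).
    by rewrite DeltaP; apply/seteqP; split=> x /= x0 i; [move=> _|]; exact: x0.
  apply: closed_bigI => i _; apply: closed_comp => [x _|].
    exact: bary_continuous.
  exact: closed_ge.
exists (\sum_i `|vertex i|); split; first exact: num_real.
move=> M /ltW Mge x; rewrite DeltaP /= => x0; apply: le_trans Mge.
rewrite -{1}(bary_comb x) (le_trans (ler_norm_sum _ _ _))// ler_sum// => i _.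
rewrite normrZ ger0_norm// ler_piMl//.
by rewrite -(bary_sum x) (bigD1 i)//= lerDl sumr_ge0.
Qed.

Lemma convex_body_Delta : convex_body (@Delta R).
Proof.
split; first exact: compact_Delta.
  by rewrite DeltaP; exact: convex_bary_ge.
exists 0; rewrite DeltaP /interior.
apply: filterS (near_bary_gt (c := 0) _) => [x x0 i|i]; first exact/ltW/x0.
by rewrite /bary raddf0 add0r; lra.
Qed.

End Tetrahedron.

(** * Lattice points and hollowness *)

Section Lattice.
Variable R : realType.
Implicit Types (x y : 'rV[R]_3) (i j k : 'I_4).
Notation s := (Num.sqrt 2 : R).

(** Numbered by the vertex opposite to the facet that contains the point. *)
Definition contact_point i : 'rV[R]_3 :=
  [:: vec3 (- 1) (- 1) (- 1); vec3 1 (- 1) 1; vec3 1 1 (- 1);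
      vec3 (- 1) 1 1]`_i.

Lemma vec3_Lambda (a b c k : int) (x y z : R) :
  x = (1 + 2 * a)%:~R -> y = (1 + 2 * b)%:~R -> z = (1 + 2 * c)%:~R ->
  (1 + 2 * a) + (1 + 2 * b) + (1 + 2 * c) = 1 + 4 * k ->
  @Lambda R (vec3 x y z).
Proof. by move=> -> -> -> abc; exists a, b, c, k. Qed.

Lemma contact_point_Lambda i : @Lambda R (contact_point i).
Proof.
move: i; apply: forall4.
- by apply: (@vec3_Lambda (-1) (-1) (-1) (-1)).
- by apply: (@vec3_Lambda 0 (-1) 0 0).
- by apply: (@vec3_Lambda 0 0 (-1) 0).
- by apply: (@vec3_Lambda (-1) 0 0 0).
Qed.

Lemma bary_contact_point i k : bary (contact_point i) k = contact R i k.
Proof.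
by move: i k; do 2 apply: forall4;
  rewrite baryE circE /normal /contact_point /= !vec3E; field: (s_sqr R).
Qed.

Lemma odd_cases (a : int) : `|(1 + 2 * a)%:~R| < 4 :> R ->
  exists2 b : int, b \in [:: -2; -1; 0; 1] & a = b.
Proof.
rewrite ltr_norml; have -> : -4 = (-4)%:~R :> R by rewrite mulrNz.
rewrite ltr_int; have -> : 4 = 4%:~R :> R by [].
by rewrite ltr_int => a4; exists a => //; rewrite !inE; lia.
Qed.

Lemma vertex_coord_lt i l : `|vertex R i 0 l| < 4.
Proof.
have /andP[s1 s2] := s_bounds R.
have h1 : - 4 < 2 + s < 4 by apply/andP; split; lra.
have h2 : - 4 < s < 4 by apply/andP; split; lra.
have h3 : - 4 < - s < 4 by apply/andP; split; lra.
have h4 : - 4 < - 2 - s < 4 by apply/andP; split; lra.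
by move: i l; apply: forall4; apply: forall3;
  rewrite /vertex /= vec3E ltr_norml.
Qed.

Lemma Delta_coord_lt x l : (forall i, 0 < bary x i) -> `|x 0 l| < 4.
Proof.
move=> x0.
have -> : 4 = \sum_i bary x i * 4 :> R by rewrite -mulr_suml bary_sum mul1r.
have {1}-> : x 0 l = \sum_i bary x i * vertex R i 0 l.
  by rewrite -{1}(bary_comb x) summxE; apply: eq_bigr => i _; rewrite mxE.
rewrite (le_lt_trans (ler_norm_sum _ _ _))// ltr_sum//.
  by apply/hasP; exists o0; rewrite ?mem_index_enum.
move=> i _; rewrite normrM gtr0_norm// ltr_pM2l//.
exact: vertex_coord_lt.
Qed.

Lemma hollow_Delta : hollow (@Lambda R) (@Delta R).
Proof.
apply/seteqP; split=> // x [[a [b [c [k [xE abc]]]]] /Delta_interior x0].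
have /andP[s1 s2] := s_bounds R.
have := Delta_coord_lt k0 x0; have := Delta_coord_lt k1 x0.
have := Delta_coord_lt k2 x0; rewrite xE !vec3E.
have := x0 o3; have := x0 o2; have := x0 o1; have := x0 o0.
rewrite !baryE /normal /= !vec3E xE !vec3E => y0 y1 y2 y3 {x0 xE x}.
move=> /odd_cases[c' + cE] /odd_cases[b' + bE] /odd_cases[a' + aE].
rewrite !inE => Cc Cb Ca; subst c' b' a'.
have Ha : (1 + 2 * a)%:~R = 1 + 2 * a%:~R :> R by rewrite rmorphD rmorphM.
have Hb : (1 + 2 * b)%:~R = 1 + 2 * b%:~R :> R by rewrite rmorphD rmorphM.
have Hc : (1 + 2 * c)%:~R = 1 + 2 * c%:~R :> R by rewrite rmorphD rmorphM.
rewrite Ha Hb Hc in y0 y1 y2 y3.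
move: (s) s1 s2 y0 y1 y2 y3 => v s1 s2 y0 y1 y2 y3.
have {}y0 : 0 < a%:~R + (v - 1) * b%:~R + (2 - v) * c%:~R + 2.
  by clear - y0; lra.
have {}y1 : 0 < (1 - v) * a%:~R + b%:~R + (v - 2) * c%:~R + 1.
  by clear - y1; lra.
have {}y2 : 0 < - a%:~R + (1 - v) * b%:~R + (2 - v) * c%:~R + 2 - v.
  by clear - y2; lra.
have {}y3 : 0 < (v - 1) * a%:~R - b%:~R + (v - 2) * c%:~R + v - 1.
  by clear - y3; lra.
have od : odd `|a + b + c| by clear - abc; lia.
have N2 : (-2)%:~R = -2 :> R by rewrite mulrNz.
have N1 : (-1)%:~R = -1 :> R by rewrite mulrNz.
move: Cc Cb Ca => /or4P[] /eqP E1 /or4P[] /eqP E2 /or4P[] /eqP E3;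
  rewrite E1 E2 E3 // ?N1 ?N2 ?mulr0z ?mulr1z in od y0 y1 y2 y3;
  clear - s1 s2 y0 y1 y2 y3;
  lra.
Qed.

End Lattice.

(** * The edge functionals *)

Section Functionals.
Variable R : realType.
Implicit Types (x y : 'rV[R]_3) (i j k : 'I_4).
Notation s := (Num.sqrt 2 : R).

(** The functionals behind [side_form] and [diag_form], oriented so as to be
    largest on Delta at vertex j. *)
Definition side_vec j : 'rV[R]_3 :=
  [:: vec3 (1 / 4) (- 1 / 4) (1 / 4); vec3 (1 / 4) (1 / 4) (- 1 / 4);
      vec3 (- 1 / 4) (1 / 4) (1 / 4); vec3 (- 1 / 4) (- 1 / 4) (- 1 / 4)]`_j.

Definition diag_vec j : 'rV[R]_3 :=
  [:: vec3 (1 / 2) 0 0; vec3 0 (1 / 2) 0; vec3 (- 1 / 2) 0 0;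
      vec3 0 (- 1 / 2) 0]`_j.

Lemma linear_LambdaP (v : 'rV[R]_3) : linear_lattice (@Lambda R) v ->
  exists a b c : int, [/\ v 0 k0 = 2 * a%:~R, v 0 k1 = 2 * b%:~R &
    v 0 k2 = 2 * (2 * c - a - b)%:~R].
Proof.
move=> [_ [a [b [c [k [-> abc]]]]] [_ [a' [b' [c' [k' [-> abc']]]]] <-]].
exists (a - a'), (b - b'), (k - k').
rewrite !mxE /=.
have -> : c = 2 * k - 1 - a - b by lia.
have -> : c' = 2 * k' - 1 - a' - b' by lia.
by rewrite !(rmorphD, rmorphM, rmorphN)/=; split; ring.
Qed.

Lemma dual_side j :
  dual_lattice (linear_lattice (@Lambda R)) (dotp (side_vec j)).
Proof.
move=> v /linear_LambdaP[a [b [c [v0 v1 v2]]]].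
have H : exists m : int, dotp (side_vec j) v = m%:~R.
  rewrite /dotp sum3 v0 v1 v2.
  move: j; apply: forall4; rewrite /side_vec /= !vec3E.
  - by exists (c - b); rewrite !(rmorphD, rmorphM, rmorphN)/=; field.
  - by exists (a + b - c); rewrite !(rmorphD, rmorphM, rmorphN)/=; field.
  - by exists (c - a); rewrite !(rmorphD, rmorphM, rmorphN)/=; field.
  - by exists (- c); rewrite !(rmorphD, rmorphM, rmorphN)/=; field.
by have [m mE] := H; rewrite (_ : _ v = m%:~R) ?intr_int.
Qed.

Lemma dual_diag j :
  dual_lattice (linear_lattice (@Lambda R)) (dotp (diag_vec j)).
Proof.
move=> v /linear_LambdaP[a [b [c [v0 v1 v2]]]].
have H : exists m : int, dotp (diag_vec j) v = m%:~R.
  rewrite /dotp sum3 v0 v1 v2.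
  move: j; apply: forall4; rewrite /diag_vec /= !vec3E.
  - by exists a; rewrite !(rmorphD, rmorphM, rmorphN)/=; field.
  - by exists b; rewrite !(rmorphD, rmorphM, rmorphN)/=; field.
  - by exists (- a); rewrite !(rmorphD, rmorphM, rmorphN)/=; field.
  - by exists (- b); rewrite !(rmorphD, rmorphM, rmorphN)/=; field.
by have [m mE] := H; rewrite (_ : _ v = m%:~R) ?intr_int.
Qed.

Lemma side_neq0 j : exists x, dotp (side_vec j) x != 0.
Proof.
exists (side_vec j); rewrite gt_eqF// dotp_gt0//.
by move: j; apply: forall4; apply/eqP => /rowP/(_ k0);
  rewrite /side_vec /= vec3E mxE; lra.
Qed.

Lemma diag_neq0 j : exists x, dotp (diag_vec j) x != 0.
Proof.
exists (diag_vec j); rewrite gt_eqF// dotp_gt0//.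
by move: j; apply: forall4; apply/eqP => /rowP h; have := h k0; have := h k1;
  rewrite /diag_vec /= !vec3E !mxE; lra.
Qed.

Lemma side_vec_bary j x y : dotp (side_vec j) x - dotp (side_vec j) y =
  (2 + s) * (\sum_k side_form R j k * (bary x k - bary y k)).
Proof.
by move: j; apply: forall4; rewrite sum4 !circE /= !baryE /normal /= !vec3E
  /dotp !sum3 /side_vec /= !vec3E; field: (s_sqr R).
Qed.

Lemma diag_vec_bary j x y : dotp (diag_vec j) x - dotp (diag_vec j) y =
  (2 + s) * (\sum_k diag_form R j k * (bary x k - bary y k)).
Proof.
by move: j; apply: forall4; rewrite sum4 !circE /= !baryE /normal /= !vec3E
  /dotp !sum3 /diag_vec /= !vec3E; field: (s_sqr R).
Qed.

(** How a lower bound on the lattice width enters the proof: for families of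
    dual functionals such as [side_vec] and [diag_vec] it yields pairs of points
    of K realizing a normalized drop of at least 1. *)
Lemma form_drop_ge1 (K : set 'rV[R]_3) (u : 'I_4 -> 'rV[R]_3) (f : 'M[R]_4) :
  (forall j, dual_lattice (linear_lattice (@Lambda R)) (dotp (u j))) ->
  (forall j, exists x, dotp (u j) x != 0) ->
  (forall j x y, dotp (u j) x - dotp (u j) y =
    (2 + s) * (\sum_k f j k * (bary x k - bary y k))) ->
  compact K -> K !=set0 -> 2 + s <= lattice_width (@Lambda R) K ->
  forall j, exists x y, [/\ K x, K y &
    1 <= \sum_k f j k * (bary x k - bary y k)].
Proof.
move=> du u0 uE cK K0 wK j.
have [x [y [Kx Ky wE]]] := width_attained (dotp (u j)) cK K0.
exists x, y; split=> //.
have /andP[s1 _] := s_bounds R.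
have s0 : 0 < 2 + s by lra.
rewrite -(ler_pM2l s0) mulr1 -uE -wE.
exact: (le_trans wK (lattice_width_le cK K0 (du j) (u0 j))).
Qed.

Lemma width_diag_vec_le j : width (@Delta R) (dotp (diag_vec j)) <= 2 + s.
Proof.
have [cD _ [x0 /interior_subset D0]] := convex_body_Delta R.
have [|x [y [Dx Dy ->]]] := width_attained (dotp (diag_vec j)) cD.
  by exists x0.
have /andP[s1 s2] := s_bounds R.
rewrite diag_vec_bary ger_pMr; last lra.
move: Dx Dy; rewrite DeltaP /= => x1 y1.
have := bary_sum x; have := bary_sum y.
have := x1 o0; have := x1 o1; have := x1 o2; have := x1 o3.
have := y1 o0; have := y1 o1; have := y1 o2; have := y1 o3.
rewrite !sum4; move: (bary x) (bary y) => X Y.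
move: j; apply: forall4; rewrite !circE /= => *; nra.
Qed.

End Functionals.

(** * The lattice width of Delta *)

Section DeltaWidth.
Variable R : realType.
Implicit Types (x y : 'rV[R]_3) (i j k : 'I_4).
Notation s := (Num.sqrt 2 : R).

Lemma dual_int (f : {scalar 'rV[R]_3}) (L : set 'rV[R]_3) x y :
  dual_lattice (linear_lattice L) f -> L x -> L y ->
  exists m : int, f x - f y = m%:~R.
Proof.
move=> df Lx Ly; apply/intrP; rewrite -raddfB; apply: df.
by exists x => //; exists y.
Qed.

(** Here X, Y, Z are four times the coordinates of a dual functional, and each
    left-hand side is its absolute drop along an edge of Delta, or the larger of
    the absolute drops along two edges, in units of (2 + s)/2. The first two
    conditions bound X and Y by 2 and the next ones bound Z by 1. *)
Lemma small_dual_zero (X Y Z m l : int) : X + Y = 2 * m -> Y + Z = 2 * l ->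
  `|X%:~R + (s - 1) * Y%:~R| < 2 -> `|Y%:~R - (s - 1) * X%:~R| < 2 ->
  `|s / 2 * X%:~R - (1 - s / 2) * Y%:~R| + `|Z%:~R| < 2 ->
  `|(1 - s / 2) * X%:~R + s / 2 * Y%:~R| + `|Z%:~R| < 2 ->
  [/\ X = 0, Y = 0 & Z = 0].
Proof.
move=> XY YZ w1 w2 w3 w4.
have /andP[s1 s2] := s_bounds R.
have Z1 : `|Z| < 2.
  rewrite -(ltr_int R) intr_norm.
  have := normr_ge0 (s / 2 * X%:~R - (1 - s / 2) * Y%:~R).
  by lra.
have [X3 Y3] : `|X| < 3 /\ `|Y| < 3.
  rewrite -!(ltr_int R) !intr_norm; move: w1 w2; rewrite !ltr_norml.
  move: (X%:~R) (Y%:~R) (s) s1 s2; clear => x y v v1 v2.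
  set t := v - 1; move=> /andP[p1 p2] /andP[q1 q2].
  have t0 : 0 < t by rewrite /t; lra.
  have t1 : t < 1 / 2 by rewrite /t; lra.
  have tt : 7 / 6 < 1 + t * t by rewrite /t; nra.
  have q1' : t * - 2 < t * (y - t * x) by rewrite ltr_pM2l.
  have q2' : t * (y - t * x) < t * 2 by rewrite ltr_pM2l.
  have p1' : t * - 2 < t * (x + t * y) by rewrite ltr_pM2l.
  have p2' : t * (x + t * y) < t * 2 by rewrite ltr_pM2l.
  have sq z : `|z * (1 + t * t)| < 3 * (7 / 6) -> - 3 < z < 3.
    rewrite -ltr_norml normrM [`|1 + _|]gtr0_norm; last lra.
    by have := normr_ge0 z; move: (`|z|) => a a0; clear - tt a0; nra.
  split; apply: sq; rewrite ltr_norml; apply/andP; split; lra.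
have abs2 (a b : R) : `|a| + `|b| < 2 ->
    [/\ a + b < 2, a - b < 2, - a + b < 2 & - a - b < 2].
  have := ler_norm a; have := ler_norm b.
  have := ler_norm (- a); have := ler_norm (- b); rewrite !normrN.
  by move: (`|a|) (`|b|) => a' b'; clear => *; split; lra.
move: w1 w2 w3 w4; rewrite !ltr_norml => /andP[w1 w1'] /andP[w2 w2'].
move=> /abs2[w3 w4 w5 w6] /abs2[w7 w8 w9 w10] {abs2}.
move: (s) s1 s2 w1 w1' w2 w2' w3 w4 w5 w6 w7 w8 w9 w10.
move=> v s1 s2 w1 w1' w2 w2' w3 w4 w5 w6 w7 w8 w9 w10.
have N2 : (-2)%:~R = -2 :> R by rewrite mulrNz.
have N1 : (-1)%:~R = -1 :> R by rewrite mulrNz.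
have : [&& Z == 0, X \in [:: -2; 0; 2] & Y \in [:: -2; 0; 2]] ||
    [&& Z \in [:: -1; 1], X \in [:: -1; 1] & Y \in [:: -1; 1]].
  by rewrite !inE; clear - XY YZ X3 Y3 Z1; lia.
rewrite !inE => /orP[/and3P[/eqP-> /or3P[] /eqP X_ /or3P[] /eqP Y_]|
  /and3P[/orP[] /eqP Z_ /orP[] /eqP X_ /orP[] /eqP Y_]].
all: rewrite ?Z_ ?X_ ?Y_ ?N1 ?N2 ?mulr0z ?mulr1z
  in w1 w1' w2 w2' w3 w4 w5 w6 w7 w8 w9 w10 *.
(* The first two conditions exclude X and Y even and not both zero, the others
   exclude them odd. *)
all: by [] || (exfalso; clear - s1 s2 w1 w1' w2 w2'; lra)
  || (exfalso; clear - w3 w4 w5 w6 w7 w8 w9 w10; lra).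
Qed.

Lemma Delta_width_ge (f : {scalar 'rV[R]_3}) :
  dual_lattice (linear_lattice (@Lambda R)) f -> (exists x, f x != 0) ->
  2 + s <= width (@Delta R) f.
Proof.
move=> df [v fv]; rewrite leNgt; apply/negP => fw.
have [cD _ _] := convex_body_Delta R.
pose u := \row_i f (delta_mx 0 i).
have fE x : f x = u 0 k0 * x 0 k0 + u 0 k1 * x 0 k1 + u 0 k2 * x 0 k2.
  by rewrite scalarE /dotp sum3.
have vw i j : f (vertex R i) - f (vertex R j) < 2 + s.
  by apply: le_lt_trans fw; apply: le_width => //; exact: vertex_Delta.
have P := @contact_point_Lambda R.
(* This point differs from a contact point by (4, 0, 0). *)
have far : @Lambda R (vec3 (- 3) 1 (- 1)).
  by apply: (@vec3_Lambda _ (-2) 0 (-1) (-1)).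
have [m mE] := dual_int df (P o2) (P o0).
have [n nE] := dual_int df (P o3) (P o0).
have [X XE] := dual_int df (P o2) far.
move: mE nE XE; rewrite !fE /contact_point /= !vec3E => mE nE XE.
have uX : u 0 k0 = X%:~R / 4 by lra.
have uY : u 0 k1 = (2 * m - X)%:~R / 4 by rewrite rmorphB rmorphM /=; lra.
have uZ : u 0 k2 = (2 * n - (2 * m - X))%:~R / 4.
  by rewrite !rmorphB !rmorphM /=; lra.
have /andP[s1 s2] := s_bounds R.
have h0 : 0 < (2 + s) / 2 by lra.
have vw' i j (c : R) :
    f (vertex R i) - f (vertex R j) = (2 + s) / 2 * c -> c < 2.
  move=> E; rewrite -(ltr_pM2l h0) -E (lt_le_trans (vw i j))//.
  by rewrite -mulrA mulVf// mulr1.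
pose x : R := X%:~R; pose y : R := (2 * m - X)%:~R.
pose z : R := (2 * n - (2 * m - X))%:~R.
move: uX uY uZ; rewrite -/x -/y -/z => uX uY uZ.
have abs2 (a b : R) : a + b < 2 -> a - b < 2 -> - a + b < 2 -> - a - b < 2 ->
    `|a| + `|b| < 2.
  by clear; move=> *; case: (ger0P a) => _; case: (ger0P b) => _; lra.
have [X0 Y0 Z0] : [/\ X = 0, 2 * m - X = 0 & 2 * n - (2 * m - X) = 0].
  apply: (@small_dual_zero _ _ _ m n); [ring|ring| | | |];
    rewrite -/x -/y -/z.
  - rewrite ltr_norml ltrNl; apply/andP; split.
      by apply: (vw' o2 o0); rewrite !fE uX uY uZ /vertex /= !vec3E;
        field: (s_sqr R).
    by apply: (vw' o0 o2); rewrite !fE uX uY uZ /vertex /= !vec3E;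
      field: (s_sqr R).
  - rewrite ltr_norml ltrNl; apply/andP; split.
      by apply: (vw' o3 o1); rewrite !fE uX uY uZ /vertex /= !vec3E;
        field: (s_sqr R).
    by apply: (vw' o1 o3); rewrite !fE uX uY uZ /vertex /= !vec3E;
      field: (s_sqr R).
  - by apply: abs2; [apply: (vw' o0 o1)|apply: (vw' o3 o2)|apply: (vw' o2 o3)|
      apply: (vw' o1 o0)]; rewrite !fE uX uY uZ /vertex /= !vec3E;
      field: (s_sqr R).
  - by apply: abs2; [apply: (vw' o0 o3)|apply: (vw' o1 o2)|apply: (vw' o2 o1)|
      apply: (vw' o3 o0)]; rewrite !fE uX uY uZ /vertex /= !vec3E;
      field: (s_sqr R).
move: fv; rewrite fE uX uY uZ /z Z0 /y Y0 /x X0.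
by rewrite !mul0r !addr0 eqxx.
Qed.

Lemma lattice_width_Delta : lattice_width (@Lambda R) (@Delta R) = 2 + s.
Proof.
have [cD _ [x0 /interior_subset D0]] := convex_body_Delta R.
have D0' : @Delta R !=set0 by exists x0.
apply/le_anti/andP; split.
  apply: le_trans (width_diag_vec_le R o0).
  by apply: lattice_width_le => //; [exact: dual_diag|exact: diag_neq0].
apply: lb_le_inf.
  exists (width (@Delta R) (dotp (diag_vec R o0))).
  exists (dotp (diag_vec R o0)) => //.
  by split; [exact: dual_diag|exact: diag_neq0].
by move=> _ [f [df f0] <-]; exact: Delta_width_ge.
Qed.

End DeltaWidth.

(** * Hollow bodies close to Delta *)

Section Squeeze.
Variable R : realType.
Implicit Types (x y : 'rV[R]_3) (i j k : 'I_4).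
Notation s := (Num.sqrt 2 : R).
Notation side_width := (edge_width (side_form R) 1).
Notation diag_width := (edge_width (diag_form R) 2).

(** On Delta the form [diag_form] number j reaches 1 at vertex j only, so a drop
    of 1 on a small enlargement of Delta forces x close to that vertex. With
    e = 0 the conclusion is that x is the vertex itself. *)
Lemma near_vertex x y j (e : R) : 0 <= e ->
  (forall k, - e <= bary x k) -> (forall k, - e <= bary y k) ->
  1 <= \sum_k diag_form R j k * (bary x k - bary y k) ->
  forall k, `|bary x k - (j == k)%:R| <= 30 * e.
Proof.
move=> e0 x0 y0; have /andP[s1 s2] := s_bounds R.
have := bary_sum x; have := bary_sum y.
rewrite !(sum4_from _ j).
have -> : diag_form R j j = 1 by move: j; apply: forall4; rewrite circE.
have -> : diag_form R j (j + 1) = 1 - s / 2.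
  by move: j; apply: forall4; rewrite ord4D circE.
have -> : diag_form R j (j + 2) = 0.
  by move: j; apply: forall4; rewrite ord4D circE.
have -> : diag_form R j (j + 3) = s / 2.
  by move: j; apply: forall4; rewrite ord4D circE.
have := x0 j; have := x0 (j + 1); have := x0 (j + 2); have := x0 (j + 3).
have := y0 j; have := y0 (j + 1); have := y0 (j + 2); have := y0 (j + 3).
move=> y3 y2 y1 {}y0 x3 x2 x1 {}x0 Sy Sx W.
suff [h0 h1 h2 h3] : [/\ `|bary x j - 1| <= 30 * e, `|bary x (j + 1)| <= 30 * e,
    `|bary x (j + 2)| <= 30 * e & `|bary x (j + 3)| <= 30 * e].
  apply: (@ord4_cases j); first by rewrite eqxx.
  - suff -> : (j == j + 1) = false by rewrite subr0.
    by clear; move: j; apply: forall4; rewrite ord4D.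
  - suff -> : (j == j + 2) = false by rewrite subr0.
    by clear; move: j; apply: forall4; rewrite ord4D.
  - suff -> : (j == j + 3) = false by rewrite subr0.
    by clear; move: j; apply: forall4; rewrite ord4D.
move: y3 y2 y1 y0 x3 x2 x1 x0 Sy Sx W.
move: (bary x j) (bary x (j + 1)) (bary x (j + 2)) (bary x (j + 3)).
move: (bary y j) (bary y (j + 1)) (bary y (j + 2)) (bary y (j + 3)).
move=> b0 b1 b2 b3 a0 a1 a2 a3; move: (s) s1 s2 => v v1 v2; clear - e0 v1 v2.
pose r := v / 2; have r1 : 7 / 10 < r by rewrite /r; lra.
have r2 : r < 5 / 7 by rewrite /r; lra.
rewrite -/r; move: r r1 r2 => r r1 r2 {v v1 v2}.
move=> y3 y2 y1 y0 x3 x2 x1 x0 Sy Sx W.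
have r0 : 0 < r by lra.
have r0' : 0 < 1 - r by lra.
have p1 : - (r * e) <= r * a1 by rewrite -mulrN ler_pM2l.
have p3 : - ((1 - r) * e) <= (1 - r) * a3 by rewrite -mulrN ler_pM2l.
have q1 : - ((1 - r) * e) <= (1 - r) * b1 by rewrite -mulrN ler_pM2l.
have q3 : - (r * e) <= r * b3 by rewrite -mulrN ler_pM2l.
(* The form is at least - 2 e at y, hence at least 1 - 2 e at x. *)
have E : r * a1 + a2 + (1 - r) * a3 <= 2 * e by lra.
have re : r * e <= e by rewrite ler_piMl//; lra.
have re' : 7 / 10 * e <= r * e by rewrite ler_wpM2r//; lra.
have h1 : a1 <= 8 * e.
  by rewrite -(ler_pM2l r0) mulrCA; lra.
have h3 : a3 <= 16 * e.
  rewrite -(ler_pM2l r0') mulrCA; have : 2 / 7 * e <= (1 - r) * e.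
    by rewrite ler_wpM2r//; lra.
  by lra.
have h2 : a2 <= 3 * e by lra.
clear - e0 x0 x1 x2 x3 Sx h1 h2 h3.
by rewrite !ler_norml; split; apply/andP; split; lra.
Qed.

(** Let b be the vector of values at the vertices of Delta of an affine form
    that is nonnegative on K and zero at the contact point. As K comes close to
    every vertex, no b k is much below 0; as the contact point is a convex
    combination with weights at least 1/4 of the vertices other than i, none of
    those b k is much above 0 either. So b is nearly a multiple of the i-th
    barycentric coordinate. *)
Lemma supporting_form (K : set 'rV[R]_3) i (h : R) :
  compact K -> convex_set K -> K !=set0 -> ~ K° (contact_point R i) ->
  0 <= h -> 16 * h < 1 ->
  (forall k, exists2 x, K x & forall l, `|bary x l - (k == l)%:R| <= h) ->
  exists c : 'I_4 -> R, [/\ c i = 1, forall k, k != i -> `|c k| <= 16 * h,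
    \sum_k contact R i k * c k = 0 &
    forall x, K x -> 0 <= \sum_k c k * bary x k].
Proof.
move=> cK vK K0 Kp h0 h1 near.
have [u u0 uK] := supporting_hyperplane cK vK K0 Kp.
pose p := contact_point R i.
pose b : 'rV[R]_4 := \row_k dotp u (p - vertex R k).
have bE x : \sum_k b 0 k * bary x k = dotp u (p - x).
  by rewrite -bary_dotp; apply: eq_bigr => k _; rewrite mxE.
have bK x : K x -> 0 <= \sum_k b 0 k * bary x k.
  by move=> Kx; rewrite bE raddfB /= subr_ge0 uK.
(* The form takes the value dotp u u at p - u, so it is not identically zero. *)
have M0 : 0 < `|b|.
  rewrite normr_gt0; apply/eqP => b0.
  have := dotp_gt0 u0; rewrite -{2}[u](subKr p) -bE b0 big1 ?ltxx// => k _.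
  by rewrite mxE mul0r.
have ble k : `|b 0 k| <= `|b| by exact: ler_mx_entry.
have bge k : - (4 * h * `|b|) <= b 0 k.
  have [x Kx xk] := near k.
  have : \sum_l b 0 l * bary x l - b 0 k =
      \sum_l b 0 l * (bary x l - (k == l)%:R).
    have -> : b 0 k = \sum_l b 0 l * (k == l)%:R.
      rewrite (bigD1 k)//= eqxx mulr1 big1 ?addr0// => l /negPf.
      by rewrite eq_sym => ->; rewrite mulr0.
    by rewrite -sumrB; apply: eq_bigr => l _; rewrite mulrBr.
  have := ler_norm_sum (index_enum 'I_4)
    (fun l => b 0 l * (bary x l - (k == l)%:R)) xpredT.
  have : \sum_(l < 4) `|b 0 l * (bary x l - (k == l)%:R)| <=
      \sum_(l < 4) (`|b| * h).
    by rewrite ler_sum// => l _; rewrite normrM ler_pM.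
  rewrite sumr_const card_ord -mulr_natl.
  move=> g1 g2 E; rewrite -E in g2; have := le_trans g2 g1; rewrite ler_norml.
  have := bK x Kx; move: (\sum_l _) (`|b|) (b 0 k) => S M t; clear.
  move=> ? /andP[_ ?].
  by lra.
have bc : \sum_k contact R i k * b 0 k = 0.
  have bp : \sum_k b 0 k * bary p k = 0 by rewrite bE subrr raddf0.
  by rewrite -[RHS]bp; apply: eq_bigr => k _; rewrite mulrC bary_contact_point.
have bsmall k : k != i -> `|b 0 k| <= 16 * h * `|b|.
  move=> ki; have ck : 1 / 4 <= contact R i k.
    have /andP[s1 s2] := s_bounds R.
    by move: ki; clear bc p b bE bK M0 ble bge u u0 uK Kp near;
      move: k i; do 2 apply: forall4 => //; rewrite circE /= => _; lra.
  move: bc; rewrite (bigD1 k)//=.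
  have : - (4 * h * `|b|) <= \sum_(l < 4 | l != k) contact R i l * b 0 l.
    apply: (@le_trans _ _
      (\sum_(l < 4 | l != k) contact R i l * - (4 * h * `|b|))).
      rewrite -mulr_suml mulrN lerN2 ler_piMl ?mulr_ge0//.
      by rewrite -(contact_sum R i) [leRHS](bigD1 k)//= lerDr contact_ge0.
    by apply: ler_sum => l _; rewrite ler_wpM2l ?contact_ge0.
  move: (bge k) (mulr_ge0 h0 (normr_ge0 b)) ck.
  move: (\sum_(l < 4 | _) _) (contact R i k) (b 0 k) (`|b|) => S q t M.
  clear => bk hM ck hS E.
  have qt : q * t <= 4 * h * M by lra.
  rewrite ler_norml; apply/andP; split; first lra.
  rewrite leNgt; apply/negP => Mt.
  have : 1 / 4 * t <= q * t by rewrite ler_wpM2r//; lra.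
  by lra.
have bi : b 0 i = `|b|.
  have [[z l] /= bl] := mx_norm_neq0 (lt0r_neq0 M0).
  rewrite [z]ord1 -[LHS]/(`|b|) in bl.
  have li : l = i.
    apply/eqP; apply: contraTT (h1) => li; rewrite -leNgt.
    by have := bsmall l li; rewrite -bl -{1}[`|b|]mul1r ler_pM2r.
  rewrite li in bl; rewrite bl ger0_norm// leNgt; apply/negP => bneg.
  have nb := ltr0_norm bneg; have := bge i; move: bl M0 bneg; rewrite nb => ->.
  move: (b 0 i) h1; clear => t h1 _ t0 ht.
  have : 0 < (1 - 4 * h) * - t by rewrite mulr_gt0//; lra.
  by lra.
exists (fun k => b 0 k / `|b|); split.
- by rewrite bi divff// gt_eqF.
- by move=> k ki; rewrite normrM normfV normr_id ler_pdivrMr// bsmall.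
- by under eq_bigr => k _ do rewrite mulrA; rewrite -mulr_suml bc mul0r.
- move=> x Kx; under eq_bigr => k _ do rewrite mulrAC.
  by rewrite -mulr_suml divr_ge0// bK.
Qed.

(** Rescaling four affine forms so that they add up to 1, which makes them the
    barycentric coordinates of the tetrahedron they cut out. *)
Lemma scale_forms (c : 'M[R]_4) (h : R) : 16 * h <= 1 ->
  (forall i, c i i = 1) -> (forall k i, k != i -> `|c k i| <= h) -> 0 <= h ->
  exists t : 'I_4 -> R, [/\ forall i, 0 < t i,
    forall k, \sum_i c k i * t i = 1 &
    `|(\matrix_(k, i) (c k i * t i)) - 1| <= 8 * h].
Proof.
move=> h16 c1 ch h0.
have d0 : `|c - 1| <= h.
  apply: mx_norm_le => // k i; rewrite !mxE.
  by have [->|ki] := eqVneq k i; rewrite ?c1 ?subrr ?normr0// subr0 ch.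
have cu : c \in unitmx by rewrite -[c](subrK 1) addrC near1_unit//; lra.
have [t ct] : exists t : 'cV[R]_4, c *m t = const_mx 1.
  by exists (invmx c *m const_mx 1); rewrite mulKVmx.
have n1 : `|const_mx 1 : 'cV[R]_4| <= 1.
  by apply: mx_norm_le => // i j; rewrite mxE normr1.
have tE : t = const_mx 1 + (1 - c) *m t.
  by rewrite mulmxBl mul1mx ct addrC subrK.
have nt : `|t| <= 2.
  have := norm_fixpoint_le (d := 1 - c) _ tE; rewrite distrC.
  by move=> /(_ ltac:(lra)) ht; rewrite (le_trans ht)//; lra.
have t1 i : `|t i 0 - 1| <= 8 * h.
  have -> : t i 0 - 1 = ((1 - c) *m t) i 0.
    by rewrite {1}tE !mxE addrAC subrr add0r.
  rewrite (le_trans (ler_mx_entry _ _ _))// (le_trans (mulmx_norm_le _ _))//.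
  rewrite distrC; have : `|c - 1| * `|t| <= h * 2 by rewrite ler_pM.
  by lra.
have t2 i : `|t i 0| <= 2 by rewrite (le_trans (ler_mx_entry _ _ _)).
exists (fun i => t i 0); split.
- by move=> i; have := t1 i; rewrite ler_norml => /andP[]; lra.
- by move=> k; move: ct => /matrixP/(_ k 0); rewrite !mxE.
- apply: mx_norm_le => [|k i]; first by rewrite mulr_ge0.
  rewrite !mxE; have [<-|ki] := eqVneq k i.
    by rewrite c1 mul1r; exact: t1.
  rewrite subr0 normrM (@le_trans _ _ (h * 2))//; first by rewrite ler_pM// ch.
  by lra.
Qed.

(** Here l and m are the barycentric coordinates, in the tetrahedron whose
    vertices are the rows of [a], of two of its points: an affine form varies
    between these points at most as much as between the vertices where it is
    extremal. *)
Lemma edge_width_ge (f a : 'M[R]_4) (d : 'I_4) j (l m : 'I_4 -> R) :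
  (forall k, 0 <= l k) -> \sum_k l k = 1 ->
  (forall k, 0 <= m k) -> \sum_k m k = 1 ->
  (forall i, (a *m f^T) (j + d) j <= (a *m f^T) i j <= (a *m f^T) j j) ->
  \sum_k f j k * (\sum_i l i * a i k - \sum_i m i * a i k)
    <= edge_width f d a j.
Proof.
move=> l0 l1 m0 m1 va; set v := fun i => (a *m f^T) i j.
have sumE (w : 'I_4 -> R) :
    \sum_k f j k * (\sum_i w i * a i k) = \sum_i w i * v i.
  under eq_bigr => k _ do rewrite mulr_sumr.
  rewrite exchange_big /=; apply: eq_bigr => i _.
  rewrite /v mxE mulr_sumr; apply: eq_bigr => k _; rewrite mxE; ring.
have -> : edge_width f d a j = v j - v (j + d).
  rewrite /edge_width /v !mxE -sumrB; apply: eq_bigr => k _; rewrite mxE; ring.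
under eq_bigr => k _ do rewrite mulrBr.
rewrite sumrB !sumE lerB//.
  rewrite -[leRHS]mul1r -l1 mulr_suml ler_sum// => i _.
  by rewrite ler_wpM2l//; case/andP: (va i).
rewrite -[leLHS]mul1r -m1 mulr_suml ler_sum// => i _.
by rewrite ler_wpM2l//; case/andP: (va i).
Qed.

(** Each form has one largest and one smallest vertex value on Delta, with the
    other two well in between, so the order persists on a nearby
    tetrahedron. *)
Lemma vertex_values_sorted (f a : 'M[R]_4) (d : 'I_4) j :
  `|a - 1| <= 1 / 40 -> \sum_k `|f j k| <= 3 -> f j j = 1 -> f j (j + d) = 0 ->
  (forall i, i != j -> i != j + d -> 1 / 4 <= f j i <= 3 / 4) ->
  forall i, (a *m f^T) (j + d) j <= (a *m f^T) i j <= (a *m f^T) j j.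
Proof.
move=> a1 fs fj fd fm.
have near i : `|(a *m f^T) i j - f j i| <= 3 / 40.
  have -> : (a *m f^T) i j - f j i = \sum_k (a - 1) i k * f j k.
    have -> : \sum_k (a - 1) i k * f j k = ((a - 1) *m f^T) i j.
      by rewrite mxE; apply: eq_bigr => k _; rewrite [f^T _ _]mxE.
    by rewrite mulmxBl mul1mx !mxE.
  rewrite (le_trans (ler_norm_sum _ _ _))//.
  apply: (@le_trans _ _ (\sum_k 1 / 40 * `|f j k|)).
    apply: ler_sum => k _; rewrite normrM ler_wpM2r//.
    by rewrite (le_trans (ler_mx_entry _ _ _)).
  by rewrite -mulr_sumr; lra.
move=> i; move: (near i) (near j) (near (j + d)) (fm i); rewrite fj fd.
have [->|ij] := eqVneq i j; last have [->|id] := eqVneq i (j + d).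
all: rewrite ?fj ?fd.
all: move: ((a *m f^T) _ _) ((a *m f^T) _ _).
- move=> u v; clear; rewrite !ler_norml => /andP[? ?] _ /andP[? ?] _.
  by apply/andP; split; lra.
- move=> u v; clear; rewrite !ler_norml => /andP[? ?] /andP[? ?] _ _.
  by apply/andP; split; lra.
move: ((a *m f^T) _ _) (f j i) => u v x y; clear; rewrite !ler_norml.
move=> /andP[? ?] /andP[? ?] /andP[? ?] /(_ isT isT)/andP[? ?].
by apply/andP; split; lra.
Qed.

Lemma side_values_sorted (a : 'M[R]_4) j : `|a - 1| <= 1 / 40 -> forall i,
  (a *m (side_form R)^T) (j + 1) j <= (a *m (side_form R)^T) i j
    <= (a *m (side_form R)^T) j j.
Proof.
move=> a1; have /andP[s1 s2] := s_bounds R.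
apply: vertex_values_sorted => //; first exact: side_form_sum.
- by move: j; apply: forall4; rewrite circE.
- by move: j; apply: forall4; rewrite ord4D circE.
- have b1 : 1 / 4 <= s / 2 <= 3 / 4 by apply/andP; split; lra.
  apply: (@ord4_cases j); rewrite ?eqxx// => _ _.
    by move: j; apply: forall4; rewrite ord4D circE.
  by move: j; apply: forall4; rewrite ord4D circE.
Qed.

Lemma diag_values_sorted (a : 'M[R]_4) j : `|a - 1| <= 1 / 40 -> forall i,
  (a *m (diag_form R)^T) (j + 2) j <= (a *m (diag_form R)^T) i j
    <= (a *m (diag_form R)^T) j j.
Proof.
move=> a1; have /andP[s1 s2] := s_bounds R.
apply: vertex_values_sorted => //; first exact: diag_form_sum.
- by move: j; apply: forall4; rewrite circE.
- by move: j; apply: forall4; rewrite ord4D circE.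
- have b1 : 1 / 4 <= s / 2 <= 3 / 4 by apply/andP; split; lra.
  have b2 : 1 / 4 <= 1 - s / 2 <= 3 / 4 by apply/andP; split; lra.
  apply: (@ord4_cases j); rewrite ?eqxx// => _ _.
    by move: j; apply: forall4; rewrite ord4D circE.
  by move: j; apply: forall4; rewrite ord4D circE.
Qed.

Lemma edge_width1 (f : 'M[R]_4) d j : f j j = 1 -> f j (j + d) = 0 ->
  edge_width f d 1 j = 1.
Proof.
move=> f1 f0; rewrite /edge_width; under eq_bigr => k _ do rewrite mulrBr.
rewrite sumrB (bigD1 j)//= !mxE eqxx f1 mulr1 big1 => [|k kj]; last first.
  by rewrite mxE eq_sym (negPf kj) mulr0.
rewrite addr0 (bigD1 (j + d))//= !mxE eqxx f0 mul0r big1 => [|k kj]; last first.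
  by rewrite mxE eq_sym (negPf kj) mulr0.
by rewrite addr0 subr0.
Qed.

(** The hypothesis on e leaves room for the losses on the way to [rigidity]: a
    factor 30 in [near_vertex], 16 in [supporting_form], 8 in [scale_forms] and
    2 from b to w. *)
Lemma sub_Delta (K : set 'rV[R]_3) (e : R) :
  0 <= e -> 16 * (16 * (30 * e)) <= 1 / 40 / 40 / 40 ->
  compact K -> convex_set K -> K !=set0 ->
  (forall i, ~ K° (contact_point R i)) ->
  (forall x, K x -> forall i, - e <= bary x i) ->
  (forall j, exists x y, [/\ K x, K y &
    1 <= \sum_k side_form R j k * (bary x k - bary y k)]) ->
  (forall j, exists x y, [/\ K x, K y &
    1 <= \sum_k diag_form R j k * (bary x k - bary y k)]) ->
  K `<=` @Delta R.
Proof.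
move=> e0; set h := 30 * e => he.
have h0 : 0 <= h by rewrite mulr_ge0.
set r : R := 1 / 40 / 40 / 40 in he *.
have r1 : r <= 1 / 40 by rewrite /r; lra.
have h16 : 16 * h < 1 by clear - he r1; lra.
have h16' : 16 * (16 * h) <= 1 by clear - he r1; lra.
have h16_0 : 0 <= 16 * h by rewrite mulr_ge0.
have h128 : 8 * (16 * h) <= r / 2 by clear - he; lra.
have r0 : 0 <= r by rewrite /r; lra.
have r2 : r / 2 <= 1 / 8 by clear - r1 r0; lra.
have r3 : r / 2 <= r by clear - r0; lra.
have r4 : 2 * (r / 2) = r by field.
move=> cK vK K0 Kp Ke sideK diagK.
have near k : exists2 x, K x & forall l, `|bary x l - (k == l)%:R| <= h.
  have [x [y [Kx Ky xy]]] := diagK k.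
  by exists x => //; apply: near_vertex xy => //; exact: Ke.
have /choice[c0 cP] i := supporting_form cK vK K0 (Kp i) h0 h16 near.
pose c : 'M[R]_4 := \matrix_(k, i) c0 i k.
have [t [t0 ct1 ct]] : exists t : 'I_4 -> R, [/\ forall i, 0 < t i,
    forall k, \sum_i c k i * t i = 1 &
    `|(\matrix_(k, i) (c k i * t i)) - 1| <= 8 * (16 * h)].
  apply: (@scale_forms c (16 * h)); [exact: h16'| | |exact: h16_0].
    by move=> i; rewrite mxE; have [] := cP i.
  by move=> k i ki; rewrite mxE; have [_ + _ _] := cP i; exact.
(* Column i of B holds the vertex values of the i-th barycentric coordinate of
   the circumscribed tetrahedron; the rows of the inverse A are the vertices of
   that tetrahedron. *)
set B := \matrix_(k, i) _ in ct.
have BE k i : B k i = c0 i k * t i by rewrite !mxE.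
have B1 k : \sum_i B k i = 1.
  by rewrite -[RHS](ct1 k); apply: eq_bigr => i _; rewrite BE mxE.
clearbody B.
have ct' : `|B - 1| <= r / 2 by exact: (le_trans ct h128).
have Bu : B \in unitmx.
  by rewrite -[B](subrK 1) addrC near1_unit//; exact: (le_trans ct' r2).
pose A := invmx B.
have A1 : forall k, \sum_i A k i = 1.
  apply/row_sums1P; have /row_sums1P {1}<- := B1.
  by rewrite mulKmx.
pose b := B - 1; pose w := A - 1.
have bw : b + w + b *m w = 0.
  rewrite /b mulmxBl [B *m w]mulmxBr mulmx1 mul1mx mulmxV//.
  by rewrite addrACA -[1%:M - B]opprB !subrr addr0.
have nw : `|w| <= 2 * `|b|.
  rewrite -[`|b|]normrN; apply: (@norm_fixpoint_le _ _ _ _ (- b)).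
    by rewrite normrN; exact: (le_trans ct' r2).
  apply/eqP; rewrite -subr_eq0 mulNmx opprD !opprK addrA [w + b]addrC.
  by apply/eqP.
have sum1 i : \sum_j (1 : 'M[R]_4) i j = 1.
  rewrite (bigD1 i)//= mxE eqxx big1 ?addr0// => j ji.
  by rewrite mxE eq_sym (negPf ji).
have sumB1 (a : 'M[R]_4) : (forall i, \sum_j a i j = 1) ->
    forall i, \sum_j (a - 1) i j = 0.
  move=> a1 i; under eq_bigr => j _ do rewrite mxE [(- 1 : 'M[R]_4) i j]mxE.
  by rewrite sumrB a1 sum1 subrr.
have Pb i : (contact R *m b) i i = 0.
  rewrite mulmxBr mulmx1 mxE [(- contact R) i i]mxE.
  have -> : contact R i i = 0 by move: (i); apply: forall4; rewrite circE.
  rewrite subr0 mxE; have [_ _ ci _] := cP i.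
  have -> : \sum_k contact R i k * B k i =
      (\sum_k contact R i k * c0 i k) * t i.
    by rewrite mulr_suml; apply: eq_bigr => k _; rewrite BE; ring.
  by rewrite ci mul0r.
(* The barycentric coordinates of x in the circumscribed tetrahedron. *)
pose l x i := \sum_k bary x k * B k i.
have l0 x : K x -> forall i, 0 <= l x i.
  move=> Kx i; have [_ _ _ /(_ x Kx) cx] := cP i.
  suff -> : l x i = (\sum_k c0 i k * bary x k) * t i by rewrite mulr_ge0// ltW.
  by rewrite mulr_suml; apply: eq_bigr => k _; rewrite BE; ring.
have l1 x : \sum_i l x i = 1.
  rewrite exchange_big /= -[RHS](bary_sum x); apply: eq_bigr => k _.
  by rewrite -mulr_sumr B1 mulr1.
have lA x k : bary x k = \sum_i l x i * A i k.
  pose X : 'rV[R]_4 := \row_k bary x k.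
  have : (X *m B) *m A = X by rewrite mulmxK.
  move=> /matrixP/(_ 0 k); rewrite mxE [in RHS]mxE => <-.
  apply: eq_bigr => i _; congr (_ * _); rewrite mxE.
  by apply: eq_bigr => z _; rewrite [X 0 z]mxE.
have wr : `|w| <= r by rewrite (le_trans nw)// -r4 ler_pM2l.
have a1 : `|A - 1| <= 1 / 40 by exact: (le_trans wr r1).
have wE (f : 'M[R]_4) d j : f j j = 1 -> f j (j + d) = 0 ->
    1 <= edge_width f d A j -> 0 <= edge_width f d w j.
  move=> f1 f0; have -> : A = 1 + w by rewrite /w addrC subrK.
  by rewrite edge_widthD edge_width1// lerDl.
(* Each drop is 1 on Delta and at least 1 on the circumscribed tetrahedron. *)
have sw j : 0 <= side_width w j.
  apply: wE.
  - by move: j; apply: forall4; rewrite circE.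
  - by move: j; apply: forall4; rewrite ord4D circE.
  have [x [y [Kx Ky xy]]] := sideK j; rewrite (le_trans xy)//.
  under eq_bigr => k _ do rewrite (lA x) (lA y).
  apply: edge_width_ge => //; [exact: l0|exact: l0|].
  exact: side_values_sorted.
have dw j : 0 <= diag_width w j.
  apply: wE.
  - by move: j; apply: forall4; rewrite circE.
  - by move: j; apply: forall4; rewrite ord4D circE.
  have [x [y [Kx Ky xy]]] := diagK j; rewrite (le_trans xy)//.
  under eq_bigr => k _ do rewrite (lA x) (lA y).
  apply: edge_width_ge => //; [exact: l0|exact: l0|].
  exact: diag_values_sorted.
have b0 : b = 0.
  apply: (@rigidity _ b w) => //.
  - exact: (le_trans ct' r3).
  - exact: sumB1.
  - exact: sumB1.
move=> x Kx; rewrite DeltaP => i; have := l0 x Kx i.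
have -> : l x i = \sum_k bary x k * (1 : 'M[R]_4) k i.
  apply: eq_bigr => k _; congr (_ * _).
  by rewrite -[B](subrK 1) -/b b0 add0r.
rewrite (bigD1 i)//= mxE eqxx mulr1 big1 ?addr0// => k ki.
by rewrite mxE (negPf ki) mulr0.
Qed.

End Squeeze.

Theorem corollary1p3 (R : realType) :
  [/\ convex_body (@Delta R),
      hollow (@Lambda R) (@Delta R),
      lattice_width (@Lambda R) (@Delta R) = 2 + Num.sqrt 2 &
      exists U : set 'rV[R]_3,
        [/\ open U, @Delta R `<=` U &
            forall K : set 'rV[R]_3,
              convex_body K -> K `<=` U -> hollow (@Lambda R) K ->
              K <> @Delta R ->
              lattice_width (@Lambda R) K < 2 + Num.sqrt 2]].
Proof.
split; [exact: convex_body_Delta|exact: hollow_Delta|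
  exact: lattice_width_Delta|].
pose e : R := 1 / 40 / 40 / 40 / 16 / 16 / 30.
have e0 : 0 < e by rewrite /e; lra.
have e1 : 16 * (16 * (30 * e)) <= 1 / 40 / 40 / 40 by rewrite /e; lra.
exists [set x | forall i, - e < bary x i]; split.
- by rewrite openE => x /= xe; exact: near_bary_gt.
- by rewrite DeltaP => x x0 i; rewrite (lt_le_trans _ (x0 i))// oppr_lt0.
move=> K [cK vK [x0 /interior_subset Kx0]] KU hK KD.
rewrite ltNge; apply/negP => wK.
have K0 : K !=set0 by exists x0.
have sideK := form_drop_ge1 (@dual_side R) (@side_neq0 R) (@side_vec_bary R)
  cK K0 wK.
have diagK := form_drop_ge1 (@dual_diag R) (@diag_neq0 R) (@diag_vec_bary R)
  cK K0 wK.
have Kp i : ~ K° (contact_point R i).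
  move=> Kpi; suff : (set0 : set 'rV[R]_3) (contact_point R i) by [].
  by rewrite -hK; split=> //; exact: contact_point_Lambda.
have Ke x : K x -> forall i, - e <= bary x i by move=> Kx i; exact/ltW/KU.
have KsubD := sub_Delta (ltW e0) e1 cK vK K0 Kp Ke sideK diagK.
apply: KD; apply/seteqP; split => // x; rewrite DeltaP => /= xge.
rewrite -(bary_comb x); apply: convex_comb => // [|j]; first exact: bary_sum.
have [y [z [Ky Kz yz]]] := diagK j.
have D0 v : K v -> forall k, - 0 <= bary v k.
  by move=> /KsubD; rewrite DeltaP oppr0.
have yv := near_vertex (lexx 0) (D0 y Ky) (D0 z Kz) yz.
suff -> : vertex R j = y by [].
apply: bary_inj => k; rewrite bary_vertex; have := yv k.
by rewrite mulr0 normr_le0 subr_eq0 => /eqP ->.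
Qed.
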